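(* Let $n$ take values only in an infinite set of odd square-free integers greater than $1$ such that \[ \frac{(\log n)^7}{p_n}\to 0 \quad\text{as } n\to\infty, \] where $p_n$ is the smallest prime factor of $n$, and let $r$ be real. Let $J(z)=\sum_{j=1}^{n-1}\left(\frac{j}{n}\right)z^j$ be the character polynomial of degree $n-1$ and let $V$ be drawn uniformly at random from $\mathcal{V}_n$. Then, as $n\to\infty$, \[ F(J_r+V_r)\to f(r)\quad\text{in probability}. \]
   Context: For real $\alpha\ge1$ and $A\in\mathbb{C}[z]$, $\|A\|_\alpha=\left(\frac{1}{2\pi}\int_0^{2\pi}|A(e^{i\theta})|^\alpha d\theta\right)^{1/\alpha}$. The merit factor of $A$ is $F(A)=\frac{\|A\|_2^4}{\|A\|_4^4-\|A\|_2^4}$. For a polynomial $A$ of degree at most $n-1$ and real $r$, the rotation is $A_r(z)=z^{-\lfloor nr\rfloor}A(z)\bmod (z^n-1)$. $\left(\frac{\cdot}{n}\right)$ denotes the Jacobi symbol. $\mathcal{V}_n$ is the set of polynomials $\sum_{j=0}^{n-1}v_jz^j$ with $v_j\in\{0,-1,+1\}$ and $v_j=0$ if and only if $\gcd(j,n)=1$. The function $f$ is $1$-periodic with $f(r)=\dfrac{1}{\frac16+8\left(|r|-\frac14\right)^2}$ for $-\frac12<r\le\frac12$. *)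

(* Defs.v *)
From Stdlib Require Import Reals ZArith.
From Coquelicot Require Import Coquelicot.
From mathcomp Require Import all_boot.
Local Open Scope R_scope.

Set Implicit Arguments.
Unset Strict Implicit.
Unset Printing Implicit Defensive.

Definition squarefree (n : nat) : Prop :=
  forall p, prime p -> ~~ (p * p %| n)%N.

Definition legendre (a p : nat) : Z :=
  if p %| a then 0%Z
  else if [exists x : 'I_p, ((x * x) %% p == a %% p)%N] then 1%Z else (-1)%Z.

Definition jacobi (a n : nat) : Z :=
  foldr (fun pe acc => (legendre a pe.1 ^ Z.of_nat pe.2 * acc)%Z) 1%Z (prime_decomp n).

Definition circ (n : nat) (a : nat -> R) (t : R) : C :=
  foldr Cplus (RtoC 0)
    (map (fun j => ((a j * cos (INR j * t)), (a j * sin (INR j * t)))) (seq.iota 0 n)).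

Definition Lpow (n : nat) (a : nat -> R) (k : nat) : R :=
  (/ (2 * PI) * RInt (fun t => (Cmod (circ n a t)) ^ k) 0 (2 * PI)).

Definition merit (n : nat) (a : nat -> R) : R :=
  ((Lpow n a 2) ^ 2 / (Lpow n a 4 - (Lpow n a 2) ^ 2)).

(* floor of a real, via Stdlib's up (x < up x <= x + 1) *)
Definition Zfloor (x : R) : Z := (up x - 1)%Z.

(* rotation A_r(z) = z^{-floor(n r)} A(z) mod (z^n - 1):
   coefficient k (0 <= k < n) of A_r is a_{(k + floor(n r)) mod n}; zero for k >= n *)
Definition rot (n : nat) (r : R) (a : nat -> R) : nat -> R :=
  fun k => if (k < n)%N then
             a (Z.to_nat (Z.modulo (Z.of_nat k + Zfloor (INR n * r)) (Z.of_nat n)))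
           else 0.

Definition Jcoef (n : nat) (j : nat) : R :=
  if ((0 < j) && (j < n))%N then IZR (jacobi j n) else 0.

Definition code3 (x : 'I_3) : R :=
  if (val x == 0)%N then 0 else if (val x == 1)%N then 1 else (-1).

Definition Vcoef (n : nat) (v : {ffun 'I_n -> 'I_3}) (j : nat) : R :=
  oapp (fun i : 'I_n => code3 (v i)) 0 (insub j).

Definition Vn (n : nat) : {set {ffun 'I_n -> 'I_3}} :=
  [set v : {ffun 'I_n -> 'I_3} | [forall i : 'I_n, ((val (v i) == 0)%N == coprime i n)]].

(* representative of r modulo 1 in (-1/2, 1/2]: r - ceil(r - 1/2) *)
Definition red (r : R) : R := (r - IZR (1 - up (/2 - r))).

Definition f (r : R) : R :=
  (/ (/6 + 8 * (Rabs (red r) - /4) ^ 2)).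

Definition prob_dev (n : nat) (r eps : R) : R :=
  (INR #|[set v in Vn n |
          Rlt_dec eps (Rabs (merit n (fun k => rot n r (Jcoef n) k + rot n r (Vcoef v) k) - f r))]|
   / INR #|Vn n|).

(* Main.v *)
Require Import Defs.
From Stdlib Require Import Reals ZArith.
From Coquelicot Require Import Coquelicot.
From mathcomp Require Import all_boot all_fingroup all_order all_algebra all_solvable.
From mathcomp Require Import complex Rstruct ring lra zify.
Import Order.TTheory GRing.Theory Num.Theory.

(** The coefficients of A = J_r + V_r are signs, so ||A||_2^2 = n, and ||A||_4^4
    is the additive energy of A, the sum of a_i a_j a_k a_l over i + j = k + l.
    For indices in [0, n) with i + j = k + l mod n, the indicator of
    i + j = k + l is 1 - ((i + j - k - l) / n)^2; hence the energy is a combination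
    of the sums over the n-th roots of unity of |F|^4, E F conj(F)^2,
    D^2 conj(F)^2 and |D|^2 |F|^2, where F, D, E are the discrete Fourier
    transforms of a_i, i a_i, i^2 a_i (with i centered).  For the rotated
    Jacobi symbol, F(k) is a Gauss sum: |F(k)|^2 is n if k is prime to n and 0
    otherwise.  Treating |F| as constant thus costs only the contribution of
    the few k not prime to n, where |D| is O(n^(3/2) log n) as in the
    Polya-Vinogradov inequality; every sum is then evaluated by Parseval, and
    the energy of J_r, divided by n^2, tends to 5/3 - 2 s (1 - s) with s the
    fractional part of -2r.  Finally V_r consists of n - phi(n) = O(n log n / p_n)
    random signs, so by a fourth moment computation and Markov's inequality it
    changes the energy by o(n^2) in probability. *)

Set Implicit Arguments.
Unset Strict Implicit.
Unset Printing Implicit Defensive.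
Delimit Scope R_scope with coqR.
Delimit Scope Z_scope with coqZ.

Local Open Scope ring_scope.

(** * The Jacobi symbol *)

Definition legendreR (p a : nat) : R := IZR (legendre a p).
Definition jacobiR (n a : nat) : R := IZR (jacobi a n).

Lemma legendreR_modn p a b : (a = b %[mod p])%N -> legendreR p a = legendreR p b.
Proof.
move=> ab; rewrite /legendreR /legendre ab.
by have -> : (p %| a)%N = (p %| b)%N by rewrite /dvdn ab.
Qed.

Lemma legendreR_dvdn p a : (p %| a)%N -> legendreR p a = 0.
Proof. by rewrite /legendreR /legendre => ->. Qed.

Lemma legendreR_sqr p a : legendreR p a ^+ 2 = (~~ (p %| a)%N)%:R.
Proof.
rewrite /legendreR /legendre; case: (p %| a)%N; first by rewrite expr0n.
by case: ifP => _; rewrite ?(opp_IZR 1) ?sqrrN expr1n.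
Qed.

Lemma primitive_root_modn p : prime p -> exists g : nat,
  [/\ ~~ (p %| g)%N,
      forall a, ~~ (p %| a)%N -> exists k, (g ^ k = a %[mod p])%N &
      forall i j, (g ^ i = g ^ j %[mod p])%N -> (i = j %[mod p.-1])%N].
Proof.
move=> p_prime.
have natF a b : (a%:R == b%:R :> 'F_p) = (a == b %[mod p])%N.
  by rewrite -val_eqE /= !val_Fp_nat.
have dvdF a : (p %| a)%N = (a%:R == 0 :> 'F_p) by rewrite -[0]/(0%:R) natF mod0n.
have /cyclicP[u units_u] := field_unit_group_cyclic [set: {unit 'F_p}].
have order_u : #[u]%g = p.-1 by rewrite /order -units_u card_finField_unit card_Fp.
pose g : nat := val (val u).
have gX k : (g ^ k)%:R = val (u ^+ k)%g by rewrite natrX natr_Zp FinRing.val_unitX.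
exists g; split=> [|a|i j].
- by rewrite dvdF natr_Zp -unitfE (valP u).
- rewrite dvdF -unitfE => unit_a.
  have : FinRing.unit 'F_p unit_a \in [set: {unit 'F_p}] by rewrite inE.
  rewrite units_u => /cycleP[k eq_a]; exists k; apply/eqP.
  by rewrite -natF gX -eq_a.
- move/eqP; rewrite -natF !gX => /eqP/val_inj/eqP.
  by rewrite eq_expg_mod_order order_u => /eqP.
Qed.

Lemma odd_modn d m : ~~ odd d -> odd (m %% d) = odd m.
Proof. by move=> /negPf d_even; rewrite [in RHS](divn_eq m d) oddD oddM d_even andbF. Qed.

Lemma legendreR_primitive_root p : prime p -> odd p -> exists2 g,
  forall a, ~~ (p %| a)%N -> exists k, (g ^ k = a %[mod p])%N &
  forall k, legendreR p (g ^ k) = (-1) ^+ k.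
Proof.
move=> p_prime p_odd; have [g [g_p g_gen g_inj]] := primitive_root_modn p_prime.
have p_gt0 := prime_gt0 p_prime.
have predp_even : ~~ odd p.-1 by rewrite -oddS prednK ?p_odd.
exists g => // k; rewrite /legendreR /legendre Euclid_dvdX // (negPf g_p) /= -signr_odd.
case: ifP => [/existsP[x /eqP sqr_x]|/negbT nonresidue]; last first.
  case: (boolP (odd k)) nonresidue => // k_even /existsP[].
  exists (Ordinal (ltn_pmod (g ^ k./2) p_gt0)) => /=.
  by rewrite modnMm -expnD addnn even_halfK.
have x_p : ~~ (p %| x)%N.
  apply: contra g_p => p_x; have : (p %| g ^ k)%N by rewrite /dvdn -sqr_x -/(dvdn _ _) dvdn_mull.
  by rewrite Euclid_dvdX // => /andP[].
have [j g_j] := g_gen _ x_p.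
have /g_inj : (g ^ (j + j) = g ^ k %[mod p])%N by rewrite expnD -modnMm !g_j modnMm.
move/(congr1 odd); rewrite !odd_modn // addnn odd_double => <-.
by rewrite expr0.
Qed.

Lemma legendreRM p a b : prime p -> odd p ->
  legendreR p (a * b) = legendreR p a * legendreR p b.
Proof.
move=> p_prime p_odd.
have [p_a|a_p] := boolP (p %| a)%N.
  by rewrite (legendreR_dvdn p_a) mul0r legendreR_dvdn ?dvdn_mulr.
have [p_b|b_p] := boolP (p %| b)%N.
  by rewrite (legendreR_dvdn p_b) mulr0 legendreR_dvdn ?dvdn_mull.
have [g g_gen legendre_g] := legendreR_primitive_root p_prime p_odd.
have [[i g_i] [j g_j]] := (g_gen _ a_p, g_gen _ b_p).
have g_ij : (g ^ (i + j) = a * b %[mod p])%N by rewrite expnD -modnMm g_i g_j modnMm.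
rewrite -(legendreR_modn g_ij) -(legendreR_modn g_i) -(legendreR_modn g_j).
by rewrite !legendre_g exprD.
Qed.

Lemma legendreR1 p : prime p -> odd p -> legendreR p 1 = 1.
Proof.
move=> p_prime p_odd; have [g _ legendre_g] := legendreR_primitive_root p_prime p_odd.
exact: legendre_g 0%N.
Qed.

Lemma legendreR_nonresidue p : prime p -> odd p -> exists g, legendreR p g = -1.
Proof.
move=> p_prime p_odd; have [g _ legendre_g] := legendreR_primitive_root p_prime p_odd.
by exists (g ^ 1)%N; rewrite legendre_g.
Qed.

Lemma jacobiR_prod n a : jacobiR n a = \prod_(p <- primes n) legendreR p a ^+ logn p n.
Proof.
rewrite /jacobiR /jacobi prime_decompE.
elim: (primes n) => [|p s IHs]; first by rewrite big_nil.
by rewrite big_cons -IHs /= mult_IZR -pow_IZR RpowE.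
Qed.

Lemma jacobiR_modn n a : jacobiR n (a %% n) = jacobiR n a.
Proof.
rewrite !jacobiR_prod; apply: eq_big_seq => p.
rewrite mem_primes => /and3P[_ _ p_n].
by rewrite (@legendreR_modn p (a %% n) a) ?modn_dvdm.
Qed.

Lemma jacobiRM n a b : odd n -> jacobiR n (a * b) = jacobiR n a * jacobiR n b.
Proof.
move=> n_odd; rewrite !jacobiR_prod -big_split; apply: eq_big_seq => p.
rewrite mem_primes => /and3P[p_prime _ p_n].
by rewrite legendreRM ?exprMn // (dvdn_odd p_n).
Qed.

Lemma coprime_primes a n : (0 < n)%N ->
  coprime a n = all (fun p => ~~ (p %| a)%N) (primes n).
Proof.
move=> n_gt0; apply/idP/allP => [co_an p|a_primes].
  rewrite mem_primes => /and3P[p_prime _ p_n].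
  by rewrite -prime_coprime // (coprime_dvdl p_n) // coprime_sym.
apply: contraT => nco_an.
have gcd_gt1 : (1 < gcdn a n)%N by rewrite ltn_neqAle eq_sym nco_an gcdn_gt0 n_gt0 orbT.
have p_gcd := pdiv_dvd (gcdn a n).
have /a_primes/negP[] : pdiv (gcdn a n) \in primes n.
  by rewrite mem_primes pdiv_prime // n_gt0 (dvdn_trans p_gcd) ?dvdn_gcdr.
exact: dvdn_trans p_gcd (dvdn_gcdl _ _).
Qed.

Lemma prodr_natb (S : pzSemiRingType) (I : Type) (s : seq I) (P : pred I) :
  \prod_(i <- s) (P i)%:R = (all P s)%:R :> S.
Proof.
elim: s => [|i s IHs]; first by rewrite big_nil.
by rewrite big_cons IHs -natrM mulnb.
Qed.

Lemma jacobiR_sqr n a : (0 < n)%N -> jacobiR n a ^+ 2 = (coprime a n)%:R.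
Proof.
move=> n_gt0; rewrite coprime_primes // jacobiR_prod -prodrXl -prodr_natb.
apply: eq_big_seq => p; rewrite -logn_gt0 => logn_p.
by rewrite exprAC legendreR_sqr; case: (~~ _); rewrite ?expr1n // expr0n (gtn_eqF logn_p).
Qed.

Lemma logn_squarefree p n : prime p -> squarefree n -> (p %| n)%N -> logn p n = 1%N.
Proof.
move=> p_prime n_sqf p_n.
have n_gt0 : (0 < n)%N by case: n n_sqf {p_n} => [/(_ _ p_prime)|//]; rewrite dvdn0.
apply/eqP; rewrite eqn_leq -!pfactor_dvdn // expn1 p_n andbT leqNgt.
by rewrite -pfactor_dvdn // expnS expn1; apply: n_sqf.
Qed.

Lemma jacobiR_primitive p n : odd n -> squarefree n -> prime p -> (p %| n)%N ->
  exists2 u, (u = 1 %[mod n %/ p])%N & jacobiR n u = -1.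
Proof.
move=> n_odd n_sqf p_prime p_n.
have n_gt0 := odd_gt0 n_odd; have p_gt0 := prime_gt0 p_prime.
have odd_dvdn q : (q %| n)%N -> odd q by move=> q_n; apply: dvdn_odd q_n n_odd.
have co_np_p : coprime (n %/ p) p.
  rewrite coprime_sym prime_coprime //; apply: contra (n_sqf p p_prime) => p_np.
  by rewrite -(divnK p_n) dvdn_pmul2r.
have [g nonresidue_g] := legendreR_nonresidue p_prime (odd_dvdn p p_n).
pose u := chinese (n %/ p) p 1 g.
have u_np : (u = 1 %[mod n %/ p])%N by apply: chinese_modl.
exists u => //.
have p_primes : p \in primes n by rewrite mem_primes p_prime n_gt0.
rewrite jacobiR_prod (big_rem p) //= logn_squarefree // expr1.
rewrite (@legendreR_modn p u g) ?chinese_modr // nonresidue_g big1_seq ?mulr1 // => q.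
rewrite mem_rem_uniq ?primes_uniq // inE => /and3P[_ q_neq_p].
rewrite mem_primes => /and3P[q_prime _ q_n].
have q_np : (q %| n %/ p)%N.
  move: q_n; rewrite -{1}(divnK p_n) Euclid_dvdM // (dvdn_prime2 q_prime p_prime).
  by rewrite (negPf q_neq_p) orbF.
have u_q : (u = 1 %[mod q])%N by rewrite -(modn_dvdm u q_np) u_np modn_dvdm.
by rewrite (legendreR_modn u_q) legendreR1 ?expr1n // odd_dvdn.
Qed.

Lemma sum_dvdn_ord d n : (0 < n)%N -> (d %| n)%N -> (\sum_(a < n) (d %| a) = n %/ d)%N.
Proof.
case: n => // n _ d_n; rewrite divn_count_dvd big_nat_recr //= d_n addnC.
by rewrite -(big_mkord xpredT (fun a => nat_of_bool (d %| a)%N)) big_ltn // dvdn0.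
Qed.

Definition noncoprimes (n : nat) : nat := (\sum_(a < n) ~~ coprime a n)%N.

Lemma noncoprimes_pdiv n : (0 < n)%N -> (noncoprimes n * pdiv n <= size (primes n) * n)%N.
Proof.
move=> n_gt0.
have union_bound : (noncoprimes n <= \sum_(p <- primes n) \sum_(a < n) (p %| a))%N.
  rewrite exchange_big; apply: leq_sum => a _; rewrite coprime_primes //.
  case: allPn => //= -[p p_primes /negPn p_a].
  by rewrite (big_rem p) //= p_a.
apply: leq_trans (leq_mul union_bound (leqnn _)) _.
rewrite -sum1_size !big_distrl /= big_seq [leqRHS]big_seq.
apply: leq_sum => p; rewrite mem_primes => /and3P[p_prime _ p_n].
rewrite sum_dvdn_ord // mul1n -[leqRHS](divnK p_n).
by rewrite leq_mul2l pdiv_min_dvd ?orbT // prime_gt1.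
Qed.

Lemma expn2_size_primes n : (0 < n)%N -> (2 ^ size (primes n) <= n)%N.
Proof.
move=> n_gt0; rewrite [leqRHS](prod_prime_decomp n_gt0) prime_decompE big_map /=.
rewrite -sum1_size expn_sum big_seq [leqRHS]big_seq.
apply: leq_prod => p p_primes.
have p_gt1 : (1 < p)%N by move: p_primes; rewrite mem_primes => /andP[/prime_gt1].
by rewrite expn1 (leq_trans p_gt1) // -{1}[p]expn1 leq_exp2l // logn_gt0.
Qed.

Lemma size_primes_le_ln n : (0 < n)%N -> (size (primes n))%:R <= 2 * ln n%:R.
Proof.
move=> n_gt0; have := expn2_size_primes n_gt0; move: (size _) => k le_n.
have ln_n : k%:R * ln 2 <= ln n%:R.
  rewrite -INRE -RmultE -ln_pow; last by apply/RltP; rewrite !RealsE.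
  apply/RleP/ln_le; [apply/RltP | apply/RleP]; rewrite !RealsE /=; first by rewrite exprn_gt0.
  by rewrite -natrX ler_nat.
have := ln_lt_2; move/RltP; rewrite !RealsE /= => half_lt_ln2.
have k_ge0 := ler0n R k; nra.
Qed.

Lemma noncoprimes_ratio_le n : (0 < n)%N ->
  (noncoprimes n)%:R / n%:R <= 2 * ln n%:R / (pdiv n)%:R :> R.
Proof.
move=> n_gt0; rewrite ler_pdivlMr ?ltr0n ?pdiv_gt0 // mulrAC ler_pdivrMr ?ltr0n //.
apply: (@le_trans _ _ ((size (primes n))%:R * n%:R)).
  by rewrite -!natrM ler_nat noncoprimes_pdiv.
by rewrite ler_wpM2r ?size_primes_le_ln.
Qed.

(** * Additive energy and the discrete Fourier transform *)

Definition conv (K : pzRingType) (n : nat) (u v : nat -> K) (s : nat) : K :=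
  \sum_(i : 'I_n * 'I_n | (i.1 + i.2 == s)%N) u i.1 * v i.2.

Definition energy (K : pzRingType) (n : nat) (v : nat -> K) : K :=
  \sum_(s < n.*2) conv n v v s ^+ 2.

Lemma sum_conv (K : comPzRingType) n (u v g : nat -> K) :
  \sum_(s < n.*2) conv n u v s * g s = \sum_(i : 'I_n * 'I_n) u i.1 * v i.2 * g (i.1 + i.2)%N.
Proof.
under eq_bigr => s _ do rewrite /conv mulr_suml big_mkcond.
rewrite exchange_big /=; apply: eq_bigr => i _.
have lt_i : (i.1 + i.2 < n.*2)%N by move: (ltn_ord i.1) (ltn_ord i.2); lia.
rewrite (bigD1 (Ordinal lt_i)) //= eqxx big1 ?addr0 // => s s_neq.
by case: eqP => // s_def; case/eqP: s_neq; apply: val_inj.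
Qed.

Lemma energy_quadruples (K : comPzRingType) n (v : nat -> K) :
  energy n v = \sum_(i : 'I_n * 'I_n) \sum_(j : 'I_n * 'I_n | (i.1 + i.2 == j.1 + j.2)%N)
    v i.1 * v i.2 * (v j.1 * v j.2).
Proof.
rewrite /energy; under eq_bigr do rewrite expr2.
rewrite sum_conv; apply: eq_bigr => i _; rewrite /conv mulr_sumr.
by apply: eq_bigl => j; rewrite eq_sym.
Qed.

Lemma eq_energy (K : pzRingType) n (u v : nat -> K) :
  (forall k, (k < n)%N -> u k = v k) -> energy n u = energy n v.
Proof.
move=> eq_uv; apply: eq_bigr => s _; congr (_ ^+ 2).
by apply: eq_bigr => i _; rewrite !eq_uv.
Qed.

Lemma rmorph_energy (K L : pzRingType) (f : {rmorphism K -> L}) n (v : nat -> K) :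
  energy n (fun a => f (v a)) = f (energy n v).
Proof.
rewrite rmorph_sum; apply: eq_bigr => s _; rewrite rmorphXn rmorph_sum.
by congr (_ ^+ 2); apply: eq_bigr => i _; rewrite rmorphM.
Qed.

Lemma modn_coprime_inj n u : coprime u n -> {in gtn n &, injective (fun a => u * a %% n)%N}.
Proof.
move=> co_un a b lt_a lt_b /= /eqP.
wlog le_ba : a b lt_a lt_b / (b <= a)%N => [W|].
  by case/orP: (leq_total b a) => le /eqP eq_mod; [|apply/esym]; apply: W => //; apply/eqP.
rewrite eqn_mod_dvd ?leq_mul2l ?le_ba ?orbT // -mulnBr Gauss_dvdr 1?coprime_sym //.
by rewrite -eqn_mod_dvd // !modn_small // => /eqP.
Qed.

Lemma sum_affine_modn (V : nmodType) n k u (g : nat -> V) :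
  (0 < n)%N -> coprime u n -> (forall a, g (a %% n)%N = g a) ->
  \sum_(a < n) g (k + u * a)%N = \sum_(a < n) g a.
Proof.
move=> n_gt0 co_un g_mod.
pose h (a : 'I_n) : 'I_n := Ordinal (ltn_pmod (k + u * a) n_gt0).
have h_inj : injective h.
  move=> a b /(congr1 val) /= /eqP; rewrite eqn_modDl => /eqP eq_ab.
  by apply/val_inj/(modn_coprime_inj co_un); rewrite ?inE /=.
by rewrite [RHS](reindex_inj h_inj) /=; apply: eq_bigr => a _; rewrite g_mod.
Qed.

Lemma sum_addn_modn (V : nmodType) n k (g : nat -> V) :
  (0 < n)%N -> (forall a, g (a %% n)%N = g a) ->
  \sum_(a < n) g (a + k)%N = \sum_(a < n) g a.
Proof.
move=> n_gt0 g_mod; rewrite -(@sum_affine_modn _ n k 1 g) ?coprime1n //.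
by apply: eq_bigr => a _; rewrite mul1n addnC.
Qed.

Lemma sum_ord_natr (K : comPzRingType) n : 2 * \sum_(a < n) a%:R = n%:R * (n%:R - 1) :> K.
Proof.
elim: n => [|n IHn]; first by rewrite !big_ord0; ring.
by rewrite !big_ord_recr /= mulrDr IHn -addn1 natrD; ring.
Qed.

Section Fourier.
Variables (C : numClosedFieldType) (n : nat) (z : C).
Hypothesis z_prim : n.-primitive_root z.

Let n_gt0 : (0 < n)%N. Proof. exact: prim_order_gt0 z_prim. Qed.
Let nC_neq0 : n%:R != 0 :> C. Proof. by rewrite pnatr_eq0 -lt0n. Qed.

Lemma prim_rootX_norm a : `|z ^+ a| = 1.
Proof.
have /eqP := congr1 Num.norm (prim_expr_order z_prim).
by rewrite !normrX normr1 pexprn_eq1 // (gtn_eqF n_gt0) => /eqP ->; rewrite expr1n.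
Qed.

Lemma prim_rootX_conjK a : z ^+ a * (z ^+ a)^* = 1.
Proof. by rewrite -normCK prim_rootX_norm expr1n. Qed.

Lemma prim_rootX_conj a : (z ^+ a)^* = z ^+ (n.-1 * a).
Proof.
apply: (@mulfI _ (z ^+ a)); first by rewrite -normr_gt0 prim_rootX_norm ltr01.
rewrite prim_rootX_conjK -exprD -mulSn prednK //.
by rewrite exprM (prim_expr_order z_prim) expr1n.
Qed.

Lemma prim_rootX_eqmod a b : (a = b %[mod n])%N -> z ^+ a = z ^+ b.
Proof. by move=> eq_ab; apply/eqP; rewrite (eq_prim_root_expr z_prim) eq_ab. Qed.

Lemma prim_root_orthogonality a b :
  \sum_(k < n) z ^+ (a * k) * (z ^+ (b * k))^* = if (a == b %[mod n])%N then n%:R else 0.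
Proof.
pose w := z ^+ a * (z ^+ b)^*.
rewrite (eq_bigr (fun k : 'I_n => w ^+ k)) => [|k _]; last by rewrite !exprM rmorphXn exprMn.
rewrite -(eq_prim_root_expr z_prim); case: eqP => [eq_ab|neq_ab].
  rewrite (eq_bigr (fun=> 1)) ?sumr_const ?card_ord // => k _.
  by rewrite /w eq_ab prim_rootX_conjK expr1n.
have w_neq1 : w - 1 != 0.
  apply/eqP => /eqP; rewrite subr_eq0 => /eqP w1; apply: neq_ab.
  by rewrite -[LHS]mulr1 -(prim_rootX_conjK b) mulrCA mulrC -/w w1 mul1r.
have zXn c : (z ^+ c) ^+ n = 1 by rewrite exprAC (prim_expr_order z_prim) expr1n.
by apply: (mulfI w_neq1); rewrite mulr0 -subrX1 exprMn -rmorphXn !zXn rmorph1 mulr1 subrr.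
Qed.

Definition dft (f : nat -> C) (k : nat) : C := \sum_(a < n) f a * z ^+ (a * k).

Lemma parseval_indexed (I J : finType) (alpha : I -> nat) (beta : J -> nat)
    (f : I -> C) (g : J -> C) :
  \sum_(k < n) (\sum_i f i * z ^+ (alpha i * k)) * (\sum_j g j * z ^+ (beta j * k))^* =
  n%:R * \sum_i \sum_(j | (alpha i == beta j %[mod n])%N) f i * (g j)^*.
Proof.
under eq_bigr => k _ do rewrite rmorph_sum big_distrlr /=.
rewrite exchange_big mulr_sumr; apply: eq_bigr => i _.
rewrite exchange_big mulr_sumr [RHS]big_mkcond; apply: eq_bigr => j _ /=.
under eq_bigr => k _ do rewrite rmorphM mulrACA.
rewrite -mulr_sumr prim_root_orthogonality.
by case: ifP => _; rewrite ?mulr0 // mulrC.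
Qed.

Lemma parseval f g : \sum_(k < n) dft f k * (dft g k)^* = n%:R * \sum_(a < n) f a * (g a)^*.
Proof.
rewrite /dft (parseval_indexed (@nat_of_ord n) (@nat_of_ord n)).
congr (_ * _); apply: eq_bigr => a _.
by rewrite (big_pred1 a) // => b; rewrite /= !modn_small // eq_sym; exact: val_eqE.
Qed.

Lemma dft_inversion f a : (a < n)%N ->
  n%:R * f a = \sum_(k < n) dft f k * (z ^+ (a * k))^*.
Proof.
move=> lt_a; pose delta b : C := (b == a)%:R.
have delta0 (b : 'I_n) : b != Ordinal lt_a -> delta b = 0.
  by move=> neq_ba; rewrite /delta (negPf (neq_ba : val b != a)).
have dft_delta k : z ^+ (a * k) = dft delta k.
  rewrite /dft (bigD1 (Ordinal lt_a)) //= /delta eqxx mul1r big1 ?addr0 // => b /delta0.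
  by rewrite /delta => ->; rewrite mul0r.
under eq_bigr => k _ do rewrite dft_delta.
rewrite parseval (bigD1 (Ordinal lt_a)) //= /delta eqxx rmorph1 mulr1 big1 ?addr0 // => b /delta0.
by rewrite /delta => ->; rewrite rmorph0 mulr0.
Qed.

Definition cyclic_energy (f g h k : nat -> C) : C :=
  \sum_(i : 'I_n * 'I_n) \sum_(j : 'I_n * 'I_n | (i.1 + i.2 == j.1 + j.2 %[mod n])%N)
    f i.1 * g i.2 * (h j.1 * k j.2)^*.
Local Notation Q := cyclic_energy.

Lemma cyclic_energy_dft f g h k :
  n%:R * Q f g h k = \sum_(x < n) dft f x * dft g x * (dft h x * dft k x)^*.
Proof.
have dft_mul (u v : nat -> C) x :
    dft u x * dft v x = \sum_(i : 'I_n * 'I_n) u i.1 * v i.2 * z ^+ ((i.1 + i.2) * x).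
  rewrite /dft big_distrlr /= pair_big /=; apply: eq_bigr => i _.
  by rewrite mulnDl exprD mulrACA.
under eq_bigr => x _ do rewrite !dft_mul.
by rewrite (parseval_indexed (fun i : 'I_n * 'I_n => i.1 + i.2)%N
              (fun i : 'I_n * 'I_n => i.1 + i.2)%N).
Qed.

Lemma cyclic_energyCl f g h k : Q f g h k = Q g f h k.
Proof.
apply: (mulfI nC_neq0); rewrite !cyclic_energy_dft.
by apply: eq_bigr => x _; rewrite [dft f x * _]mulrC.
Qed.

Lemma cyclic_energyCr f g h k : Q f g h k = Q f g k h.
Proof.
apply: (mulfI nC_neq0); rewrite !cyclic_energy_dft.
by apply: eq_bigr => x _; rewrite [dft h x * _]mulrC.
Qed.

Lemma cyclic_energy_conj f g h k : (Q f g h k)^* = Q h k f g.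
Proof.
apply: (mulfI nC_neq0); rewrite -{1}conjC_nat -rmorphM !cyclic_energy_dft.
rewrite rmorph_sum; apply: eq_bigr => x _ /=.
by rewrite [(_ * (dft h x * _)^*)^*]rmorphM /= conjCK mulrC.
Qed.

(* The difference of two sums of residues is one of -n, 0, n once it vanishes modulo n. *)
Lemma eq_addn_indicator a b c d :
  (a < n)%N -> (b < n)%N -> (c < n)%N -> (d < n)%N -> (a + b == c + d %[mod n])%N ->
  (a + b == c + d)%N%:R = 1 - (a%:R + b%:R - c%:R - d%:R) ^+ 2 / n%:R ^+ 2 :> C.
Proof.
move=> lt_a lt_b lt_c lt_d.
wlog le_cd_ab : a b c d lt_a lt_b lt_c lt_d / (c + d <= a + b)%N => [W|].
  case/orP: (leq_total (c + d) (a + b)) => le eq_mod; first exact: W.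
  by rewrite eq_sym W // 1?eq_sym //; congr (1 - _ / _); ring.
rewrite eqn_mod_dvd // => /dvdnP[q diff].
have lt_q2 : (q < 2)%N by rewrite -(ltn_pmul2r n_gt0) -diff; lia.
have -> : a%:R + b%:R - c%:R - d%:R = (q * n)%:R :> C by rewrite -diff natrB // !natrD; ring.
case: q lt_q2 diff => [|[|//]] _ diff.
  have -> : (a + b == c + d)%N by lia.
  by rewrite mul0n expr0n mul0r subr0.
have -> : (a + b == c + d)%N = false by lia.
by rewrite mul1n divff ?subrr // expf_neq0.
Qed.

Definition centered (a : nat) : C := a%:R - n.-1%:R / 2.
Definition moment1 (v : nat -> C) (a : nat) : C := centered a * v a.
Definition moment2 (v : nat -> C) (a : nat) : C := centered a ^+ 2 * v a.

Lemma centered_real a : (centered a)^* = centered a.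
Proof. by rewrite /centered rmorphB rmorphM fmorphV !rmorph_nat. Qed.

Lemma sum_centered : \sum_(a < n) centered a = 0.
Proof.
apply: (@mulfI _ 2); first by rewrite pnatr_eq0.
rewrite mulr0 /centered sumrB mulrBr sum_ord_natr sumr_const card_ord -[(_ / 2) *+ n]mulr_natr.
have -> : n%:R = n.-1%:R + 1 :> C by rewrite -{1}(prednK n_gt0) -addn1 natrD.
by field.
Qed.

Section RealSequence.
Variable v : nat -> C.
Hypothesis v_real : forall a, (v a)^* = v a.

Lemma moment1_real a : (moment1 v a)^* = moment1 v a.
Proof. by rewrite /moment1 rmorphM /= centered_real v_real. Qed.

Lemma energy_cyclic_energy :
  n%:R ^+ 2 * energy n v = n%:R ^+ 2 * Q v v v v
    - 2 * (Q (moment2 v) v v v + (Q (moment2 v) v v v)^*)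
    - 2 * (Q (moment1 v) (moment1 v) v v + (Q (moment1 v) (moment1 v) v v)^*)
    + 8 * Q (moment1 v) v (moment1 v) v.
Proof.
set v1 := moment1 v; set v2 := moment2 v.
transitivity (n%:R ^+ 2 * Q v v v v -
   (Q v2 v v v + Q v v2 v v + Q v v v2 v + Q v v v v2 + 2 * Q v1 v1 v v + 2 * Q v v v1 v1
    - 2 * Q v1 v v1 v - 2 * Q v1 v v v1 - 2 * Q v v1 v1 v - 2 * Q v v1 v v1)); last first.
  rewrite !cyclic_energy_conj [Q v v2 v v]cyclic_energyCl [Q v v v v2]cyclic_energyCr.
  rewrite [Q v v1 v1 v]cyclic_energyCl [Q v v1 v v1]cyclic_energyCl.
  by rewrite [Q v1 v v v1]cyclic_energyCr; ring.
rewrite /Q energy_quadruples !mulr_sumr -!sumrN -?big_split -?sumrN -?big_split /=.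
apply: eq_bigr => i _.
rewrite !mulr_sumr -!sumrN -?big_split -?sumrN -?big_split /= big_mkcond [RHS]big_mkcond /=.
apply: eq_bigr => j _.
have [eq_ij|neq_ij] := boolP (i.1 + i.2 == j.1 + j.2 %[mod n])%N; last first.
  by case: (i.1 + i.2 =P j.1 + j.2)%N neq_ij => // ->; rewrite eqxx.
transitivity (n%:R ^+ 2 * ((i.1 + i.2 == j.1 + j.2)%N%:R * (v i.1 * v i.2 * (v j.1 * v j.2)))).
  by case: (_ == _); rewrite ?mul1r // mul0r mulr0.
rewrite eq_addn_indicator // !rmorphM /= !centered_real !v_real.
by rewrite /v1 /v2 /moment1 /moment2 /centered; field.
Qed.

End RealSequence.
End Fourier.

(** * The energy of a real primitive character *)

Lemma sum_natr_geometric (K : comPzRingType) (w : K) n :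
  (w - 1) * \sum_(a < n) a%:R * w ^+ a = n%:R * w ^+ n - w * \sum_(a < n) w ^+ a.
Proof.
elim: n => [|n IHn]; first by rewrite !big_ord0; ring.
by rewrite !big_ord_recr /= mulrDr IHn -addn1 natrD exprD expr1; ring.
Qed.

Section ChordSum.
Variables (C : numClosedFieldType) (n : nat) (z : C).
Hypothesis z_prim : n.-primitive_root z.

(* The term x = 0 is 0^-1 = 0. *)
Definition chord_sum : C := \sum_(x < n) `|1 - z ^+ x|^-1.

Lemma chord_sum_ge0 : 0 <= chord_sum.
Proof. by apply: sumr_ge0 => x _; rewrite invr_ge0. Qed.

Lemma norm_sum_centered_prim_rootX y :
  `|\sum_(a < n) centered C n a * (z ^+ y) ^+ a| <= n%:R * `|1 - z ^+ y|^-1.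
Proof.
set w := z ^+ y; have [->|w_neq1] := eqVneq w 1.
  under eq_bigr do rewrite expr1n mulr1.
  by rewrite (sum_centered z_prim) normr0 mulr_ge0 ?invr_ge0.
have wn1 : w ^+ n = 1 by rewrite /w exprAC (prim_expr_order z_prim) expr1n.
have w_subr1 : w - 1 != 0 by rewrite subr_eq0.
have sum_w : \sum_(a < n) w ^+ a = 0.
  by apply: (mulfI w_subr1); rewrite -subrX1 wn1 subrr mulr0.
have -> : \sum_(a < n) centered C n a * w ^+ a = n%:R / (w - 1).
  rewrite /centered; under eq_bigr do rewrite mulrBl.
  rewrite sumrB -mulr_sumr sum_w mulr0 subr0; apply: (mulfI w_subr1).
  by rewrite sum_natr_geometric wn1 sum_w mulr0 subr0 mulr1 mulrCA divff ?mulr1.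
by rewrite normrM normr_nat normfV distrC.
Qed.

End ChordSum.

(* As n.-1 stands for -1, this is the residue of - a - 2 r modulo n. *)
Definition reflect_idx (n r a : nat) : nat := ((n.-1 * (a + 2 * r)) %% n)%N.

Section ReflectIdx.
Variables (n r : nat).
Hypothesis n_gt0 : (0 < n)%N.
Local Notation s := (reflect_idx n r).

Lemma coprime_predn : coprime n.-1 n.
Proof. by rewrite -[X in coprime _ X](prednK n_gt0) coprimenS. Qed.

Lemma ltn_reflect_idx a : (s a < n)%N.
Proof. exact: ltn_pmod. Qed.

Lemma addn_predn_mul a : (a + n.-1 * a = 0 %[mod n])%N.
Proof. by rewrite -mulSn prednK // modnMr mod0n. Qed.

Lemma reflect_idxP a b : (b < n)%N -> (a + 2 * r == n.-1 * b %[mod n])%N = (b == s a).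
Proof.
move=> lt_b; rewrite -{2}(modn_small lt_b) /reflect_idx.
rewrite -(eqn_modDl b) -(eqn_modDr (n.-1 * (a + 2 * r))).
have -> : (b + (a + 2 * r) + n.-1 * (a + 2 * r) = b %[mod n])%N.
  by rewrite -addnA -modnDmr addn_predn_mul modnDmr addn0.
by rewrite -(modnDml (b + _)) addn_predn_mul modnDml add0n.
Qed.

Lemma sum_reflect_idx (V : nmodType) (g : nat -> V) : \sum_(a < n) g (s a) = \sum_(a < n) g a.
Proof.
pose g' a := g (a %% n)%N.
transitivity (\sum_(a < n) g' (n.-1 * (2 * r) + n.-1 * a)%N).
  by apply: eq_bigr => a _; rewrite /g' /reflect_idx -mulnDr addnC.
rewrite (@sum_affine_modn _ n _ n.-1 g') ?coprime_predn // => [|a]; last by rewrite /g' modn_mod.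
by apply: eq_bigr => a _; rewrite /g' modn_small.
Qed.

End ReflectIdx.

Lemma ler_norm_natB (K : numDomainType) (a b n : nat) :
  (a <= n)%N -> (b <= n)%N -> `|a%:R - b%:R| <= n%:R :> K.
Proof.
wlog le_ba : a b / (b <= a)%N => [W|] le_an le_bn.
  by case/orP: (leq_total b a) => le; [|rewrite distrC]; apply: W.
by rewrite -natrB // normr_nat ler_nat (leq_trans (leq_subr _ _)).
Qed.

Section RealCharacter.
Variables (C : numClosedFieldType) (n : nat) (z : C) (chi : nat -> C).
Hypothesis z_prim : n.-primitive_root z.
Hypothesis n_gt1 : (1 < n)%N.
Hypothesis chi_mod : forall a, chi (a %% n)%N = chi a.
Hypothesis chiM : forall a b, chi (a * b)%N = chi a * chi b.
Hypothesis chi_sqr : forall a, chi a ^+ 2 = (coprime a n)%:R.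
Hypothesis chi_real : forall a, (chi a)^* = chi a.
Hypothesis chi_primitive : forall p, prime p -> (p %| n)%N ->
  exists2 u, (u = 1 %[mod n %/ p])%N & chi u = -1.

Let n_gt0 : (0 < n)%N. Proof. exact: ltnW. Qed.
Let nC_gt0 : 0 < n%:R :> C. Proof. by rewrite ltr0n. Qed.
Let nC_ge0 : 0 <= n%:R :> C. Proof. exact: ltW. Qed.
Let nC_neq0 : n%:R != 0 :> C. Proof. exact: lt0r_neq0. Qed.

Lemma chi_eqmod a b : (a = b %[mod n])%N -> chi a = chi b.
Proof. by move=> eq_ab; rewrite -chi_mod eq_ab chi_mod. Qed.

Lemma chi_neq0_coprime a : chi a != 0 -> coprime a n.
Proof. by rewrite -sqrf_eq0 chi_sqr; case: coprime; rewrite ?eqxx. Qed.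

Lemma chi_cube k : chi k ^+ 2 * chi k = chi k.
Proof.
have [->|/chi_neq0_coprime co_kn] := eqVneq (chi k) 0; first by rewrite mulr0.
by rewrite chi_sqr co_kn mul1r.
Qed.

Lemma chi_predn_sqr : chi n.-1 * chi n.-1 = 1.
Proof. by rewrite -expr2 chi_sqr coprime_predn. Qed.

Lemma chi_prim_rootX_modn a k : chi (a %% n)%N * z ^+ (a %% n * k) = chi a * z ^+ (a * k).
Proof.
by rewrite chi_mod; congr (_ * _); apply: (prim_rootX_eqmod z_prim); rewrite modnMml.
Qed.

Lemma dft_chi_mul u k : coprime u n -> chi u * dft n z chi (u * k) = dft n z chi k.
Proof.
move=> co_un; pose g a := chi a * z ^+ (a * k).
rewrite -[RHS](@sum_affine_modn _ n 0 u g) // => [|a]; last exact: chi_prim_rootX_modn.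
rewrite /dft mulr_sumr; apply: eq_bigr => a _.
by rewrite /g add0n chiM mulrA [(a * (u * k))%N]mulnCA mulnA.
Qed.

Definition gauss : C := dft n z chi 1.

(* If the prime p divides n and k, a unit u = 1 mod n / p with chi(u) = -1 satisfies
   u k = k mod n, so that the transform at k is its own opposite. *)
Lemma dft_character k : dft n z chi k = chi k * gauss.
Proof.
have [co_kn|nco_kn] := boolP (coprime k n).
  by rewrite /gauss -(@dft_chi_mul k 1) // muln1 mulrA -expr2 chi_sqr co_kn mul1r.
have -> : chi k = 0 by apply/eqP; rewrite -sqrf_eq0 chi_sqr (negPf nco_kn).
move: nco_kn; rewrite mul0r coprime_primes // => /allPn[p + /negPn p_k].
rewrite mem_primes => /and3P[p_prime _ p_n].
have [u u_np chi_u] := chi_primitive p_prime p_n.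
have co_un : coprime u n by apply: chi_neq0_coprime; rewrite chi_u oppr_eq0 oner_eq0.
have uk_k : (u * k = k %[mod n])%N.
  have [q ->] := dvdnP p_k.
  rewrite -[n in RHS](divnK p_n) -[n in LHS](divnK p_n) mulnA -!muln_modl.
  by congr (_ * _)%N; rewrite -modnMml u_np modnMml mul1n.
have dft_uk : dft n z chi (u * k) = dft n z chi k.
  apply: eq_bigr => a _; congr (_ * _); apply: (prim_rootX_eqmod z_prim).
  by rewrite -modnMmr uk_k modnMmr.
have := dft_chi_mul k co_un.
by rewrite dft_uk chi_u mulN1r => /eqP; rewrite eq_sym -addr_eq0 -mulr2n mulrn_eq0 => /eqP.
Qed.

Lemma gauss_mul_conj : gauss * gauss^* = n%:R.
Proof.
have := parseval z_prim chi chi.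
under eq_bigr => k _.
  rewrite dft_character rmorphM /= chi_real mulrACA -expr2 chi_sqr; over.
under [in RHS]eq_bigr => k _ do rewrite chi_real -expr2 chi_sqr.
rewrite -mulr_suml mulrC; apply: mulIf.
rewrite (bigD1 (Ordinal n_gt1)) //= coprime1n.
by rewrite lt0r_neq0 // ltr_pwDl ?ltr01 // sumr_ge0 // => i _; rewrite ler0n.
Qed.

Lemma gauss_conj : gauss^* = chi n.-1 * gauss.
Proof.
rewrite -dft_character /gauss /dft rmorph_sum; apply: eq_bigr => a _ /=.
by rewrite rmorphM /= chi_real (prim_rootX_conj z_prim) muln1 mulnC.
Qed.

Definition off_support : C := \sum_(a < n) (1 - chi a ^+ 2).

Lemma off_support_term_ge0 a : 0 <= 1 - chi a ^+ 2.
Proof. by rewrite chi_sqr subr_ge0 lern1 leq_b1. Qed.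

Lemma off_support_ge0 : 0 <= off_support.
Proof. by apply: sumr_ge0 => a _; apply: off_support_term_ge0. Qed.

Lemma sum_chi_sqr : \sum_(a < n) chi a ^+ 2 = n%:R - off_support.
Proof. by rewrite /off_support sumrB sumr_const card_ord opprB addrC subrK. Qed.

Variable r : nat.
Let v a := chi (a + r)%N.
Local Notation t := (centered C n).
Local Notation v1 := (moment1 n v).
Local Notation v2 := (moment2 n v).
Local Notation F := (dft n z v).
Local Notation D := (dft n z v1).
Local Notation E := (dft n z v2).
Local Notation s := (reflect_idx n r).

Let v_real a : (v a)^* = v a. Proof. exact: chi_real. Qed.

Lemma dft_shift k : F k = (z ^+ (r * k))^* * chi k * gauss.
Proof.
suff dft_rot : z ^+ (r * k) * F k = chi k * gauss.
  by rewrite -mulrA -dft_rot mulrA [_^* * _]mulrC (prim_rootX_conjK z_prim) mul1r.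
pose g a := chi a * z ^+ (a * k).
rewrite -dft_character -[RHS](@sum_addn_modn _ n r g) // => [|a]; last first.
  exact: chi_prim_rootX_modn.
rewrite /dft mulr_sumr.
by apply: eq_bigr => a _; rewrite /g /v mulnDl exprD; ring.
Qed.

Lemma dft_shift_mul_conj k : F k * (F k)^* = n%:R * chi k ^+ 2.
Proof.
rewrite dft_shift !rmorphM /= conjCK chi_real.
transitivity ((z ^+ (r * k) * (z ^+ (r * k))^*) * (gauss * gauss^*) * chi k ^+ 2); first by ring.
by rewrite (prim_rootX_conjK z_prim) gauss_mul_conj mul1r.
Qed.

Lemma chi_sqr_dft_shift k : chi k ^+ 2 * F k = F k.
Proof. by rewrite dft_shift -[in RHS](chi_cube k); ring. Qed.

Lemma dft_shift_conj_sqr k : (F k)^* ^+ 2 = n%:R * chi n.-1 * z ^+ (2 * r * k) * chi k ^+ 2.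
Proof.
rewrite dft_shift !rmorphM /= conjCK chi_real -mulnA mul2n -addnn exprD.
transitivity (chi k ^+ 2 * (z ^+ (r * k) * z ^+ (r * k)) * (gauss^* * gauss^*)); first by ring.
by rewrite {1}gauss_conj -[chi _ * gauss * _]mulrA gauss_mul_conj; ring.
Qed.

Lemma dft_shift_le k : `|F k| <= sqrtC n%:R.
Proof.
rewrite -(@ler_pXn2r _ 2) ?nnegrE ?sqrtC_ge0 // sqrtCK normCK dft_shift_mul_conj chi_sqr.
by rewrite ler_piMr // lern1 leq_b1.
Qed.

Lemma dft_moment1_inversion k :
  n%:R * D k = \sum_(l < n) F l * \sum_(a < n) t a * (z ^+ (k + n.-1 * l)) ^+ a.
Proof.
under [RHS]eq_bigr do rewrite mulr_sumr.
rewrite exchange_big /= {1}/dft mulr_sumr; apply: eq_bigr => a _; rewrite /moment1.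
transitivity (t a * z ^+ (a * k) * (n%:R * v a)); first by ring.
rewrite (dft_inversion z_prim v (ltn_ord a)) mulr_sumr; apply: eq_bigr => l _.
rewrite (prim_rootX_conj z_prim) -exprM mulnDl exprD [(k * a)%N]mulnC -mulnA [(l * a)%N]mulnC.
by ring.
Qed.

(* By Fourier inversion, D(k) is an average of the F(l), of modulus at most sqrt n, against
   the transform of the centered identity, which decays like the inverse chord length. *)
Lemma dft_moment1_le k : `|D k| ^+ 2 <= n%:R * chord_sum n z ^+ 2.
Proof.
pose inv_chord x := `|1 - z ^+ x|^-1.
have D_le : `|D k| <= sqrtC n%:R * chord_sum n z.
  rewrite -(ler_pM2l nC_gt0) -{1}(normr_nat C n) -normrM dft_moment1_inversion.
  rewrite /chord_sum -(@sum_affine_modn _ n k n.-1 inv_chord) ?coprime_predn //; last first.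
    by move=> a; rewrite /inv_chord (prim_expr_mod z_prim).
  rewrite [sqrtC _ * _]mulr_sumr mulr_sumr; apply: le_trans (ler_norm_sum _ _ _) _.
  apply: ler_sum => l _; rewrite normrM mulrCA.
  by apply: ler_pM => //; [apply: dft_shift_le | apply: norm_sum_centered_prim_rootX].
apply: le_trans (lerXn2r 2 _ _ D_le) _; rewrite ?nnegrE ?mulr_ge0 ?sqrtC_ge0 ?chord_sum_ge0 //.
by rewrite exprMn sqrtCK.
Qed.

Lemma chi_reflect_idx a : v (s a) = chi n.-1 * v a.
Proof.
rewrite /v -chiM; apply: chi_eqmod; rewrite /reflect_idx modnDml.
rewrite mul2n -addnn addnA [in LHS]mulnDr -addnA -modnDmr [(n.-1 * r + r)%N]addnC.
by rewrite addn_predn_mul // modnDmr addn0.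
Qed.

Lemma chi_reflect_idx_sqr a : v (s a) ^+ 2 = v a ^+ 2.
Proof. by rewrite chi_reflect_idx exprMn expr2 chi_predn_sqr mul1r. Qed.

Let M20 : C := \sum_(a < n) t a ^+ 2 * v a ^+ 2.
Let M11 : C := \sum_(a < n) t a * t (s a) * v a ^+ 2.

Lemma sum_twisted_moment1_sqr : \sum_(k < n) D k ^+ 2 * z ^+ (2 * r * k) = n%:R * chi n.-1 * M11.
Proof.
transitivity (\sum_(k < n) (\sum_(a < n) v1 a * z ^+ ((a + 2 * r) * k)) *
    (\sum_(b < n) v1 b * z ^+ ((n.-1 * b) * k))^*).
  apply: eq_bigr => k _; rewrite expr2 mulrAC; congr (_ * _).
    by rewrite /dft mulr_suml; apply: eq_bigr => a _; rewrite mulnDl exprD; ring.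
  rewrite /dft rmorph_sum; apply: eq_bigr => b _ /=.
  rewrite rmorphM /= (moment1_real n v_real); congr (_ * _).
  by rewrite -mulnA -(prim_rootX_conj z_prim) conjCK.
rewrite (parseval_indexed z_prim (fun a : 'I_n => a + 2 * r)%N (fun b : 'I_n => n.-1 * b)%N).
rewrite -[RHS]mulrA [chi _ * _]mulr_sumr; congr (_ * _); apply: eq_bigr => a _.
rewrite (big_pred1 (Ordinal (ltn_reflect_idx r n_gt0 a))) => [|b]; last exact: reflect_idxP.
by rewrite (moment1_real n v_real) /= /moment1 chi_reflect_idx; ring.
Qed.

(* The errors made when chi(k)^2 is replaced by 1. *)
Definition moment_defect : C := \sum_(k < n) (1 - chi k ^+ 2) * `|D k| ^+ 2.
Definition twisted_defect : C := \sum_(k < n) (1 - chi k ^+ 2) * (D k ^+ 2 * z ^+ (2 * r * k)).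

Lemma cyclic_energy_character : cyclic_energy n v v v v = n%:R * \sum_(k < n) chi k ^+ 2.
Proof.
apply: (mulfI nC_neq0); rewrite (cyclic_energy_dft z_prim) mulrA mulr_sumr.
apply: eq_bigr => k _; rewrite rmorphM /= mulrACA dft_shift_mul_conj.
transitivity (n%:R * n%:R * chi k * (chi k ^+ 2 * chi k)); first by ring.
by rewrite chi_cube; ring.
Qed.

Lemma cyclic_energy_moment2 : cyclic_energy n v2 v v v = n%:R * M20.
Proof.
apply: (mulfI nC_neq0); rewrite (cyclic_energy_dft z_prim).
transitivity (\sum_(k < n) n%:R * (E k * (F k)^*)).
  apply: eq_bigr => k _; rewrite rmorphM /= mulrA -(mulrA (E k)) dft_shift_mul_conj.
  by rewrite -[in RHS](chi_sqr_dft_shift k) rmorphM rmorphXn /= chi_real; ring.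
rewrite -mulr_sumr (parseval z_prim); congr (_ * (_ * _)).
by apply: eq_bigr => a _; rewrite v_real /moment2; ring.
Qed.

Lemma cyclic_energy_moment11 :
  cyclic_energy n v1 v1 v v = n%:R * M11 - chi n.-1 * twisted_defect.
Proof.
apply: (mulfI nC_neq0); rewrite (cyclic_energy_dft z_prim).
transitivity (n%:R * chi n.-1 * (\sum_(k < n) D k ^+ 2 * z ^+ (2 * r * k) - twisted_defect)).
  rewrite /twisted_defect -sumrB mulr_sumr; apply: eq_bigr => k _.
  by rewrite rmorphM /= -!expr2 dft_shift_conj_sqr; ring.
rewrite sum_twisted_moment1_sqr.
transitivity (n%:R * (n%:R * (chi n.-1 * chi n.-1) * M11 - chi n.-1 * twisted_defect));
  first by ring.
by rewrite chi_predn_sqr mulr1.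
Qed.

Lemma cyclic_energy_moment1 : cyclic_energy n v1 v v1 v = n%:R * M20 - moment_defect.
Proof.
apply: (mulfI nC_neq0); rewrite (cyclic_energy_dft z_prim).
transitivity (n%:R * (\sum_(x < n) D x * (D x)^* - moment_defect)).
  rewrite /moment_defect -sumrB mulr_sumr; apply: eq_bigr => x _.
  by rewrite rmorphM /= mulrACA dft_shift_mul_conj normCK; ring.
rewrite (parseval z_prim); congr (_ * (_ * _ - _)).
by apply: eq_bigr => a _; rewrite (moment1_real n v_real) /moment1; ring.
Qed.

Definition weighted_reflect_sum : C := \sum_(a < n) (a%:R - (s a)%:R) ^+ 2 * v a ^+ 2.

Lemma weighted_reflect_sumE : weighted_reflect_sum = 2 * (M20 - M11).
Proof.
have -> : 2 * (M20 - M11) = M20 + M20 - 2 * M11 by ring.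
rewrite {2}/M20 -(sum_reflect_idx r n_gt0 (fun a => t a ^+ 2 * v a ^+ 2)) mulr_sumr.
rewrite -big_split -sumrB; apply: eq_bigr => a _.
by rewrite /= chi_reflect_idx_sqr /centered; ring.
Qed.

Lemma energy_character_defects :
  n%:R ^+ 2 * energy n v = n%:R ^+ 3 * \sum_(k < n) chi k ^+ 2 + 2 * n%:R * weighted_reflect_sum
    + (2 * chi n.-1 * (twisted_defect + twisted_defect^*) - 8 * moment_defect).
Proof.
have M20_real : M20^* = M20.
  rewrite rmorph_sum; apply: eq_bigr => a _.
  by rewrite rmorphM !rmorphXn /= v_real centered_real.
have M11_real : M11^* = M11.
  by rewrite rmorph_sum; apply: eq_bigr => a _; rewrite !rmorphM /= v_real !centered_real.
rewrite (@energy_cyclic_energy _ n z) // cyclic_energy_character cyclic_energy_moment2.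
rewrite cyclic_energy_moment11 cyclic_energy_moment1 weighted_reflect_sumE.
by rewrite rmorphB !rmorphM /= conjC_nat M20_real M11_real chi_real; ring.
Qed.

Lemma moment_defect_le : moment_defect <= off_support * (n%:R * chord_sum n z ^+ 2).
Proof.
rewrite /moment_defect mulr_suml; apply: ler_sum => k _.
by apply: ler_wpM2l; [apply: off_support_term_ge0 | apply: dft_moment1_le].
Qed.

Lemma twisted_defect_le : `|twisted_defect| <= moment_defect.
Proof.
apply: le_trans (ler_norm_sum _ _ _) _; apply: ler_sum => k _.
rewrite normrM (ger0_norm (off_support_term_ge0 k)) normrM (prim_rootX_norm z_prim).
by rewrite mulr1 normrX.
Qed.

Lemma defects_le :
  `|2 * chi n.-1 * (twisted_defect + twisted_defect^*) - 8 * moment_defect| <=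
  12 * moment_defect.
Proof.
have chi_norm : `|chi n.-1| = 1.
  have /eqP := congr1 Num.norm chi_predn_sqr.
  by rewrite -expr2 normrX normr1 pexprn_eq1 //= => /eqP.
have defect_ge0 := le_trans (normr_ge0 _) twisted_defect_le.
have -> : 12 * moment_defect = 2 * (moment_defect + moment_defect) + 8 * moment_defect by ring.
apply: le_trans (ler_normB _ _) _; rewrite [`|8 * _|]normrM normr_nat (ger0_norm defect_ge0).
rewrite lerD2r !normrM chi_norm normr_nat mulr1 ler_wpM2l ?ler0n //.
apply: le_trans (ler_normD _ _) _.
by apply: lerD; rewrite ?norm_conjC; apply: twisted_defect_le.
Qed.

Lemma weighted_reflect_sum_close :
  `|weighted_reflect_sum - \sum_(a < n) (a%:R - (s a)%:R) ^+ 2| <= off_support * n%:R ^+ 2.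
Proof.
have -> : off_support = \sum_(a < n) (1 - v a ^+ 2).
  by rewrite (@sum_addn_modn _ n r (fun a => 1 - chi a ^+ 2)) // => a; rewrite chi_mod.
rewrite -sumrB mulr_suml; apply: le_trans (ler_norm_sum _ _ _) _; apply: ler_sum => a _.
set gap := (_ - _) ^+ 2.
have -> : gap * v a ^+ 2 - gap = - ((1 - v a ^+ 2) * gap) by ring.
rewrite normrN normrM (ger0_norm (off_support_term_ge0 _)) ler_wpM2l ?off_support_term_ge0 //.
by rewrite normrX lerXn2r ?nnegrE // ler_norm_natB // ltnW ?ltn_reflect_idx.
Qed.

Lemma energy_character_close :
  `|n%:R ^+ 2 * energy n v - (n%:R ^+ 4 + 2 * n%:R * \sum_(a < n) (a%:R - (s a)%:R) ^+ 2)| <=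
  off_support * (3 * n%:R ^+ 3 + 12 * n%:R * chord_sum n z ^+ 2).
Proof.
rewrite energy_character_defects sum_chi_sqr.
set defects := _ - 8 * _; set R2 := \sum_(a < n) _; set W := weighted_reflect_sum.
have -> : n%:R ^+ 3 * (n%:R - off_support) + 2 * n%:R * W + defects - (n%:R ^+ 4 + 2 * n%:R * R2) =
  2 * n%:R * (W - R2) - n%:R ^+ 3 * off_support + defects by ring.
have -> : off_support * (3 * n%:R ^+ 3 + 12 * n%:R * chord_sum n z ^+ 2) =
    2 * n%:R * (off_support * n%:R ^+ 2) + n%:R ^+ 3 * off_support
    + 12 * (off_support * (n%:R * chord_sum n z ^+ 2)) by ring.
apply: le_trans (ler_normD _ _) _; apply: lerD; last first.
  by apply: le_trans defects_le _; rewrite ler_wpM2l ?ler0n ?moment_defect_le.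
apply: le_trans (ler_normB _ _) _; apply: lerD.
  by rewrite !normrM !normr_nat ler_wpM2l ?weighted_reflect_sum_close ?mulr_ge0 ?ler0n.
by rewrite ger0_norm // mulr_ge0 ?exprn_ge0 ?off_support_ge0.
Qed.

End RealCharacter.

(** * Random signs *)

Lemma sqr_diff_le (K : realFieldType) (x y e : K) : 0 < e ->
  `|y ^+ 2 - x ^+ 2| <= e * x ^+ 2 + (1 + e^-1) * (y - x) ^+ 2.
Proof.
move=> e_gt0; have [d ->] : exists d, y = x + d by exists (y - x); ring.
have ler_cross (sgn : K) : sgn ^+ 2 = 1 -> 2 * sgn * (x * d) <= e * x ^+ 2 + e^-1 * d ^+ 2.
  move=> sgn_sqr; rewrite -subr_ge0.
  have -> : e * x ^+ 2 + e^-1 * d ^+ 2 - 2 * sgn * (x * d) =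
      e * (x - sgn * e^-1 * d) ^+ 2 + (1 - sgn ^+ 2) * e^-1 * d ^+ 2 by field; rewrite gt_eqF.
  by rewrite sgn_sqr subrr !mul0r addr0 mulr_ge0 ?sqr_ge0 ?ltW.
have := ler_cross 1; have := ler_cross (-1); rewrite sqrrN expr1n => /(_ erefl) + /(_ erefl).
have := sqr_ge0 d; set d2 := d ^+ 2 => d2_ge0.
have -> : (x + d) ^+ 2 - x ^+ 2 = 2 * (x * d) + d2 by rewrite /d2; ring.
have -> : (x + d - x) ^+ 2 = d2 by rewrite /d2; ring.
by move=> lo hi; rewrite ler_norml; apply/andP; split; lra.
Qed.

Definition conv_sqr_dist (K : pzRingType) (n : nat) (u w : nat -> K) : K :=
  \sum_(s < n.*2) (conv n w w s - conv n u u s) ^+ 2.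

Lemma energy_close (K : realFieldType) n (u w : nat -> K) (e : K) : 0 < e ->
  `|energy n w - energy n u| <= e * energy n u + (1 + e^-1) * conv_sqr_dist n u w.
Proof.
move=> e_gt0; rewrite /energy /conv_sqr_dist -sumrB !mulr_sumr -big_split /=.
apply: le_trans (ler_norm_sum _ _ _) _; apply: ler_sum => s _.
exact: sqr_diff_le.
Qed.

Lemma convC (K : comPzRingType) n (u v : nat -> K) s : conv n u v s = conv n v u s.
Proof.
pose swap (i : 'I_n * 'I_n) := (i.2, i.1).
have swapK : involutive swap by case.
rewrite /conv (reindex_inj (inv_inj swapK)) /=.
by apply: eq_big => [i|i _]; [rewrite addnC | rewrite mulrC].
Qed.

Lemma conv_add (K : comPzRingType) n (u v : nat -> K) s :
  conv n (fun k => u k + v k) (fun k => u k + v k) s - conv n u u s =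
  2 * conv n u v s + conv n v v s.
Proof.
have -> (x y : K) : 2 * x + y = x + x + y by ring.
rewrite {2}convC /conv -!big_split -sumrB /=.
by apply: eq_bigr => i _; ring.
Qed.

Lemma convE (K : pzRingType) n (u v : nat -> K) s :
  conv n u v s = \sum_(b < n) (if (b <= s)%N && (s - b < n)%N then u (s - b)%N else 0) * v b.
Proof.
rewrite /conv big_mkcond /=.
rewrite -(pair_bigA _ (fun a b : 'I_n => if (a + b == s)%N then u a * v b else 0)) /=.
rewrite exchange_big /=; apply: eq_bigr => b _.
case: ifP => [/andP[le_bs lt_sb]|/negbT out_of_range].
  rewrite (bigD1 (Ordinal lt_sb)) //= subnK // eqxx big1 ?addr0 // => a neq_a.
  by case: eqP => // sum_s; case/eqP: neq_a; apply: val_inj => /=; lia.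
rewrite mul0r big1 // => a _; case: eqP => // sum_s.
by case/negP: out_of_range; rewrite -sum_s addnK leq_addl ltn_ord.
Qed.

Lemma markov_card (K : numDomainType) (T : finType) (A : {set T}) (Y : T -> K) (c : K) :
  (forall w, 0 <= Y w) -> #|[set w in A | c <= Y w]|%:R * c <= \sum_(w in A) Y w.
Proof.
move=> Y_ge0; rewrite mulr_natl -sumr_const [leRHS](bigID (fun w => c <= Y w)) /=.
rewrite -[leLHS]addr0 lerD ?sumr_ge0 //.
by under eq_bigl do rewrite inE; apply: ler_sum => w /andP[].
Qed.

Section RandomSigns.
Variables (K : realFieldType) (n : nat) (Omega : finType) (A : {set Omega}).
Variables (X : Omega -> nat -> K) (B : pred nat).
Hypothesis X_flip : forall i, (i < n)%N -> exists phi : Omega -> Omega,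
  [/\ injective phi, forall w, (phi w \in A) = (w \in A),
      forall w, X (phi w) i = - X w i &
      forall w j, (j < n)%N -> j != i -> X (phi w) j = X w j].
Hypothesis X_sqr : forall w i, w \in A -> (i < n)%N -> X w i ^+ 2 = (B i)%:R.

Definition support_size : nat := (\sum_(i < n) B i)%N.
Local Notation m := support_size.

Lemma support_size_le : (m <= n)%N.
Proof.
by rewrite -[leqRHS]card_ord -sum1_card; apply: leq_sum => i _; exact: leq_b1.
Qed.

Lemma sum_sign_odd i (Y : Omega -> K) : (i < n)%N ->
  (forall phi : Omega -> Omega, (forall w j, (j < n)%N -> j != i -> X (phi w) j = X w j) ->
    forall w, Y (phi w) = Y w) ->
  \sum_(w in A) X w i * Y w = 0.
Proof.
move=> lt_i Y_inv; have [phi [phi_inj phiA Xi Xj]] := X_flip lt_i.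
set S := (X in X = _); suff : S = - S by lra.
rewrite {1}/S (reindex_inj phi_inj) -sumrN /=.
apply: eq_big => [w|w _]; first exact: phiA.
by rewrite Xi (Y_inv _ Xj) mulNr.
Qed.

Lemma second_moment (c : nat -> K) : (forall i, c i ^+ 2 <= 1) ->
  \sum_(w in A) (\sum_(b < n) c b * X w b) ^+ 2 <= #|A|%:R * m%:R.
Proof.
move=> c_le1; under eq_bigr => w _ do rewrite expr2 big_distrlr /=.
rewrite exchange_big /= /support_size natr_sum mulr_sumr; apply: ler_sum => b _.
rewrite exchange_big (bigD1 b) //= [X in _ + X]big1 ?addr0 => [|b' neq_b]; last first.
  transitivity (\sum_(w in A) X w b * (c b * (c b' * X w b'))).
    by apply: eq_bigr => w _; ring.
  by apply: sum_sign_odd => // phi Xj w; rewrite Xj.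
rewrite mulr_natl -sumr_const; apply: ler_sum => w wA.
by rewrite mulrACA -!expr2 X_sqr //; case: (B b); rewrite ?mulr1 ?mulr0.
Qed.

Lemma sum_sign_sqr_pair (a b : 'I_n) :
  \sum_(w in A) X w a * X w b * (X w a * X w b) = #|A|%:R * ((B a)%:R * (B b)%:R).
Proof.
rewrite mulr_natl -sumr_const; apply: eq_bigr => w wA.
by rewrite -(X_sqr wA (ltn_ord a)) -(X_sqr wA (ltn_ord b)); ring.
Qed.

Lemma sum_sign_unpaired (a b c d : 'I_n) : (a + b = c + d)%N -> a != c -> a != d ->
  \sum_(w in A) X w a * X w b * (X w c * X w d) = 0.
Proof.
move=> eq_sum neq_ac neq_ad; have [eq_ab|neq_ab] := eqVneq a b.
  have neq_dc : (d != c :> nat) by move: eq_sum (neq_ac : a != c :> nat); rewrite -eq_ab; lia.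
  transitivity (\sum_(w in A) X w c * (X w a * X w b * X w d)).
    by apply: eq_bigr => w _; ring.
  by apply: sum_sign_odd => // phi Xj w; rewrite !Xj // -eq_ab.
transitivity (\sum_(w in A) X w a * (X w b * X w c * X w d)).
  by apply: eq_bigr => w _; ring.
by apply: sum_sign_odd => // phi Xj w; rewrite !Xj // eq_sym.
Qed.

Lemma sum_sign_quadruple_le (i j : 'I_n * 'I_n) : (i.1 + i.2 = j.1 + j.2)%N ->
  \sum_(w in A) X w i.1 * X w i.2 * (X w j.1 * X w j.2) <=
  ((j == i)%:R + (j == (i.2, i.1))%:R) * (#|A|%:R * ((B i.1)%:R * (B i.2)%:R)).
Proof.
case: i j => [a b] [c d] /= eq_sum.
have rhs_ge0 (P Q : bool) : 0 <= (P%:R + Q%:R) * (#|A|%:R * ((B a)%:R * (B b)%:R)) :> K.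
  by rewrite !mulr_ge0 ?addr_ge0 ?ler0n.
have pair_le (P Q : bool) : P || Q ->
    #|A|%:R * ((B a)%:R * (B b)%:R) <= (P%:R + Q%:R) * (#|A|%:R * ((B a)%:R * (B b)%:R)) :> K.
  move=> PQ; rewrite ler_peMl ?mulr_ge0 ?ler0n //.
  by case/orP: PQ => ->; rewrite ?lerDl ?lerDr ler0n.
have [eq_ac|neq_ac] := eqVneq a c.
  have eq_bd : b = d by apply: val_inj => /=; move: eq_sum; rewrite eq_ac; lia.
  by rewrite -eq_ac -eq_bd sum_sign_sqr_pair pair_le ?eqxx.
have [eq_ad|neq_ad] := eqVneq a d.
  have eq_bc : b = c by apply: val_inj => /=; move: eq_sum; rewrite eq_ad; lia.
  rewrite -eq_ad -eq_bc; under eq_bigr do rewrite [X _ b * X _ a]mulrC.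
  by rewrite sum_sign_sqr_pair pair_le ?eqxx ?orbT.
by rewrite sum_sign_unpaired.
Qed.

Lemma sum_energy_le : \sum_(w in A) energy n (X w) <= #|A|%:R * (2 * m%:R ^+ 2).
Proof.
under eq_bigr => w _ do rewrite energy_quadruples.
have -> : #|A|%:R * (2 * m%:R ^+ 2) =
    \sum_(i : 'I_n * 'I_n) 2 * (#|A|%:R * ((B i.1)%:R * (B i.2)%:R)) :> K.
  by rewrite -!mulr_sumr expr2 /support_size natr_sum big_distrlr pair_big /= mulrCA.
rewrite exchange_big /=; apply: ler_sum => i _; rewrite exchange_big /=.
have sum_delta (i0 : 'I_n * 'I_n) : \sum_(j : 'I_n * 'I_n) (j == i0)%:R = 1 :> K.
  by rewrite (bigD1 i0) //= eqxx big1 ?addr0 // => j /negPf ->.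
have -> : 2 * (#|A|%:R * ((B i.1)%:R * (B i.2)%:R)) =
    \sum_(j : 'I_n * 'I_n)
      ((j == i)%:R + (j == (i.2, i.1))%:R) * (#|A|%:R * ((B i.1)%:R * (B i.2)%:R)) :> K.
  by rewrite -mulr_suml big_split /= !sum_delta.
rewrite big_mkcond; apply: ler_sum => j _; case: eqP => [/sum_sign_quadruple_le //|_].
by rewrite !mulr_ge0 ?addr_ge0 ?ler0n.
Qed.

Lemma sum_conv_sqr_le (u : nat -> K) s : (forall i, u i ^+ 2 <= 1) ->
  \sum_(w in A) conv n u (X w) s ^+ 2 <= #|A|%:R * m%:R.
Proof.
move=> u_le1; under eq_bigr do rewrite convE.
apply: (second_moment (c := fun b => if (b <= s)%N && (s - b < n)%N then u (s - b)%N else 0)).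
by move=> i; case: ifP => // _; rewrite expr0n /= ler01.
Qed.

Lemma sum_conv_sqr_dist_le (u : nat -> K) : (forall i, u i ^+ 2 <= 1) ->
  \sum_(w in A) conv_sqr_dist n u (fun k => u k + X w k) <= #|A|%:R * (20 * n%:R * m%:R).
Proof.
move=> u_le1; have A_ge0 : 0 <= #|A|%:R :> K by rewrite ler0n.
have m_ge0 : 0 <= m%:R :> K by rewrite ler0n.
have split_dist w : conv_sqr_dist n u (fun k => u k + X w k) <=
    8 * \sum_(s < n.*2) conv n u (X w) s ^+ 2 + 2 * energy n (X w).
  rewrite /energy !mulr_sumr -big_split /=; apply: ler_sum => s _.
  by rewrite conv_add; have := sqr_ge0 (2 * conv n u (X w) s - conv n (X w) (X w) s); nra.
have cross_le : \sum_(w in A) \sum_(s < n.*2) conv n u (X w) s ^+ 2 <=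
    2 * n%:R * (#|A|%:R * m%:R).
  rewrite exchange_big /= -natrM mul2n mulr_natl.
  have -> (x : K) : x *+ n.*2 = \sum_(s < n.*2) x by rewrite sumr_const card_ord.
  by apply: ler_sum => s _; apply: sum_conv_sqr_le.
have m_le : #|A|%:R * m%:R * m%:R <= #|A|%:R * m%:R * n%:R :> K.
  by rewrite ler_wpM2l ?mulr_ge0 // ler_nat support_size_le.
have energy_le := sum_energy_le.
apply: le_trans (ler_sum _ (fun w _ => split_dist w)) _.
rewrite big_split -!mulr_sumr /=; lra.
Qed.

End RandomSigns.

(** * Norms on the unit circle *)

Local Notation "x %:C" := (real_complex R x%R) (format "x %:C") : ring_scope.

Definition cis (t : R) : R[i] := Complex (cos t) (sin t).
Arguments cis t%_R.

Lemma cis0 : cis 0 = 1.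
Proof. by rewrite /cis cos_0 sin_0. Qed.

Lemma cisD s t : cis (s + t) = cis s * cis t.
Proof. by rewrite /cis cosD sinD; congr Complex; rewrite /= addrC. Qed.

Lemma cisX t k : cis t ^+ k = cis (k%:R * t).
Proof.
elim: k => [|k IHk]; first by rewrite mul0r cis0.
by rewrite exprS IHk -cisD -[in RHS]addn1 natrD mulrDl mul1r addrC.
Qed.

Lemma norm_1_sub_cis t : `|1 - cis (2 * t)| = (2 * `|sin t|)%:C.
Proof.
rewrite normc_def /=; congr (_%:C).
rewrite -[RHS]ger0_norm ?mulr_ge0 // -sqrtr_sqr; congr (Num.sqrt _).
have -> : 2 * t = (2 * t)%coqR by rewrite !RealsE.
have := sin2_cos2 t; rewrite cos_2a_sin sin_2a /Rsqr !RealsE exprMn real_normK ?num_real //.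
move: (sin t) (cos t) => s c s2c2; have c2 : c ^+ 2 = 1 - s ^+ 2 by rewrite -s2c2; ring.
transitivity (4 * s ^+ 4 + 4 * s ^+ 2 * c ^+ 2); first by rewrite /=; ring.
by rewrite c2; ring.
Qed.

Definition trig_poly (n : nat) (a : nat -> R) (t : R) : R[i] :=
  \sum_(j < n) (a j)%:C * cis (j%:R * t).

Lemma trig_poly_sqr n a t : trig_poly n a t ^+ 2 = trig_poly n.*2 (conv n a a) t.
Proof.
rewrite expr2 big_distrlr pair_bigA /= /trig_poly.
transitivity (\sum_(s < n.*2) conv n (fun j => (a j)%:C) (fun j => (a j)%:C) s * cis (s%:R * t)).
  rewrite (sum_conv _ _ _ (fun s => cis (s%:R * t))); apply: eq_bigr => i _.
  by rewrite natrD mulrDl cisD mulrACA.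
apply: eq_bigr => s _; congr (_ * _).
by rewrite rmorph_sum; apply: eq_bigr => i _; rewrite rmorphM.
Qed.

Lemma trig_polyE n a t :
  trig_poly n a t =
  Complex (\sum_(j < n) a j * cos (j%:R * t)%R) (\sum_(j < n) a j * sin (j%:R * t)%R).
Proof.
rewrite /trig_poly; elim/big_rec3: _ => // j c s p _ ->.
by apply/eqP; rewrite eq_complex /=; apply/andP; split; apply/eqP; ring.
Qed.

Lemma Cmod_circ n a t : (Cmod (circ n a t))%:C = `|trig_poly n a t|.
Proof.
have -> : circ n a t =
    (\sum_(j < n) a j * cos (j%:R * t)%R, \sum_(j < n) a j * sin (j%:R * t)%R).
  rewrite /circ -!(big_mkord xpredT (fun j => a j * _ (j%:R * t)%R)) /index_iota subn0.
  elim: (seq.iota 0 n) => [|j s IHs] /=; first by rewrite !big_nil.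
  by rewrite IHs !big_cons INRE.
by rewrite trig_polyE normc_def /Cmod !RealsE.
Qed.

Lemma is_RInt_sum (m : nat) (F : nat -> R -> R) (l : nat -> R) (a b : R) :
  (forall i, is_RInt (F i) a b (l i)) ->
  is_RInt (fun t => \sum_(i < m) F i t) a b (\sum_(i < m) l i).
Proof.
move=> F_int; elim: m => [|m IHm].
  apply: (@is_RInt_ext R_NormedModule (fun _ => 0 : R)) => [t _|]; first by rewrite big_ord0.
  have := @is_RInt_const R_NormedModule a b 0.
  by rewrite big_ord0 /scal /= /mult /= Rmult_0_r.
apply: (@is_RInt_ext R_NormedModule (fun t => plus (\sum_(i < m) F i t) (F m t))) => [t _|].
  by rewrite big_ord_recr.
by rewrite big_ord_recr; apply: is_RInt_plus.
Qed.

Lemma sin_natr_2PI k : sin (k%:R * (2 * PI))%R = 0.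
Proof.
have -> : (k%:R * (2 * PI))%R = (0 + 2 * INR k * PI)%coqR by rewrite !RealsE /=; ring.
by rewrite sin_period sin_0.
Qed.

Lemma is_RInt_cos_2PI (c : R) : c != 0 -> sin (c * (2 * PI))%R = 0 ->
  is_RInt (fun t => cos (c * t)%R) 0 (2 * PI)%R 0.
Proof.
move=> c_neq0 sin_c; pose G t := (sin (c * t) / c)%coqR.
have -> : 0 = minus (G (2 * PI)%R) (G 0%coqR).
  by rewrite /G sin_c Rmult_0_r sin_0 /minus /plus /Hierarchy.opp /= !RealsE mul0r subrr.
apply: (@is_RInt_derive R_CompleteNormedModule G) => t _.
  by rewrite /G; auto_derive => //; rewrite !RealsE; field.
by apply: (ex_derive_continuous (fun t => cos (c * t)%coqR)); auto_derive.
Qed.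

Lemma is_RInt_cos_diff (j k : nat) :
  is_RInt (fun t => cos ((j%:R - k%:R) * t)%R) 0 (2 * PI)%R (if j == k then 2 * PI else 0)%R.
Proof.
have [->|neq_jk] := eqVneq j k.
  apply: (@is_RInt_ext R_NormedModule (fun _ => 1)) => [t _|]; first by rewrite subrr mul0r cos_0.
  have := @is_RInt_const R_NormedModule 0%coqR (2 * PI)%R 1.
  by rewrite /scal /= /mult /= !RealsE subr0 mulr1.
apply: is_RInt_cos_2PI; first by rewrite subr_eq0 eqr_nat.
by rewrite mulrBl sinD sin_neg cos_neg !sin_natr_2PI mul0r !RealsE oppr0 mulr0 addr0.
Qed.

Lemma is_RInt_norm_trig_poly (m : nat) (w : nat -> R) (g : R -> R) :
  (forall t, (g t)%:C = `|trig_poly m w t| ^+ 2) ->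
  is_RInt g 0 (2 * PI)%R (2 * PI * \sum_(j < m) w j ^+ 2)%R.
Proof.
move=> g_norm.
pose G j k t : R := scal (w j * w k : R) (cos ((j%:R - k%:R) * t)%R).
pose l j k : R := scal (w j * w k : R) (if j == k :> nat then 2 * PI else 0)%R.
have gE t : \sum_(j < m) \sum_(k < m) G j k t = g t.
  apply: complexI; rewrite g_norm trig_polyE -add_Re2_Im2 /=; congr _%:C.
  rewrite !expr2 !big_distrlr -big_split; apply: eq_bigr => j _ /=.
  rewrite -big_split; apply: eq_bigr => k _ /=.
  by rewrite /G mulrBl cosD sin_neg cos_neg /scal /= /mult /= !RealsE; ring.
have -> : (2 * PI * \sum_(j < m) w j ^+ 2)%R = \sum_(j < m) \sum_(k < m) l j k.
  rewrite mulr_sumr; apply: eq_bigr => j _; rewrite (bigD1 j) //= /l eqxx big1 ?addr0.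
    by rewrite /scal /= /mult /= !RealsE; ring.
  move=> k neq_kj; rewrite eq_sym (negPf (neq_kj : k != j :> nat)).
  by rewrite /scal /= /mult /= !RealsE mulr0.
apply: (@is_RInt_ext R_NormedModule) (fun t _ => gE t) _.
apply: (@is_RInt_sum m (fun j t => \sum_(k < m) G j k t) (fun j => \sum_(k < m) l j k)) => j.
apply: (@is_RInt_sum m (G j) (l j)) => k.
by apply: is_RInt_scal; apply: is_RInt_cos_diff.
Qed.

Lemma mean_norm_trig_poly (m : nat) (w : nat -> R) (g : R -> R) :
  (forall t, (g t)%:C = `|trig_poly m w t| ^+ 2) ->
  (/ (2 * PI) * RInt g 0 (2 * PI))%coqR = \sum_(j < m) w j ^+ 2.
Proof.
move=> g_norm; rewrite (is_RInt_unique _ _ _ _ (is_RInt_norm_trig_poly g_norm)) !RealsE /=.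
have PIR_neq0 : PI != 0 by apply/eqP/PI_neq0.
by rewrite mulrA mulVf ?mul1r // mulf_neq0 // pnatr_eq0.
Qed.

Lemma Lpow2 n a : Lpow n a 2 = \sum_(j < n) a j ^+ 2.
Proof. by apply: mean_norm_trig_poly => t; rewrite RpowE rmorphXn /= Cmod_circ. Qed.

Lemma Lpow4 n a : Lpow n a 4 = energy n a.
Proof.
apply: mean_norm_trig_poly => t.
by rewrite RpowE rmorphXn /= Cmod_circ -trig_poly_sqr normrX -exprM.
Qed.

(** * The standard root of unity *)

Lemma ln_le_subr1 (x : R) : 0 < x -> ln x <= x - 1.
Proof.
move=> x_gt0; have /RleP := exp_ineq1_le (ln x).
by rewrite exp_ln ?RplusE ?R1E; [lra | apply/RltP].
Qed.

Lemma harmonic_le_ln k : \sum_(x < k.+1) x.+1%:R^-1 <= 1 + ln k.+1%:R :> R.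
Proof.
elim: k => [|k IHk]; first by rewrite big_ord1 ln_1 invr1 addr0.
rewrite big_ord_recr /=; apply: le_trans (lerD IHk (lexx _)) _.
have ratio_gt0 : 0 < k.+1%:R / k.+2%:R :> R by rewrite divr_gt0 ?ltr0n.
have := ln_le_subr1 ratio_gt0.
rewrite -RdivE ln_div ?RminusE; try by apply/RltP; rewrite ltr0n.
have -> : k.+1%:R / k.+2%:R - 1 = - k.+2%:R^-1 :> R.
  have -> : k.+1%:R = k.+2%:R - 1 :> R by rewrite -[k.+2%:R]natr1 addrK.
  by rewrite mulrBl divff ?pnatr_eq0 // mul1r addrAC subrr add0r.
by rewrite -lerN2 opprK opprB lerBrDr -addrA lerD2l addrC.
Qed.

Lemma sin_ge_quarter (y : R) : 0 <= y -> y <= PI / 2 -> y / 4 <= sin y.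
Proof.
move=> y_ge0 y_le; have /RleP := PI_4; rewrite !RealsE /= => PI_le4.
have PI_ge0 : 0 <= PI by lra.
have [|| /RleP + _] := SIN y; try by apply/RleP; rewrite ?RealsE; lra.
apply: le_trans.
have -> : sin_lb y = y * (1 - y ^+ 2 / 6 + (y ^+ 2) ^+ 2 / 120 - (y ^+ 2) ^+ 3 / 5040).
  rewrite /sin_lb /sin_approx sum_f_R0E unlock /= /sin_term (opp_IZR 1) !RealsE !factS fact0 /=.
  by field.
have y2_le4 : 0 <= y ^+ 2 <= 4 by rewrite sqr_ge0; nra.
by rewrite ler_wpM2l //; move: (y ^+ 2) y2_le4 => u /andP[u_ge0 u_le4]; nra.
Qed.

Lemma sin_PI_gt0 (y : R) : 0 < y -> y < 1 -> 0 < sin (PI * y)%R.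
Proof.
have PI_gt0 : 0 < PI by apply/RltP/PI_RGT_0.
move=> y_gt0 y_lt1; apply/RltP/sin_gt_0; apply/RltP; first by rewrite mulr_gt0.
by rewrite -[ltRHS]mulr1 ltr_pM2l.
Qed.

Lemma inv_sin_PI_le (y : R) : 0 < y -> y < 1 -> (2 * sin (PI * y)%R)^-1 <= y^-1 + (1 - y)^-1.
Proof.
wlog y_le_half : y / y <= 2^-1 => [W|] y_gt0 y_lt1.
  have [/W|half_lt_y] := lerP y 2^-1; first exact.
  have sinC : sin (PI * (1 - y))%R = sin (PI * y)%R by rewrite mulrBr mulr1 -RminusE sin_PI_x.
  by have := W (1 - y); rewrite subKr sinC [_^-1 + _]addrC; apply; lra.
have /RltP := PI2_1; rewrite !RealsE /= => PI_gt2.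
have sin_ge : y / 2 <= sin (PI * y)%R.
  by apply: le_trans (@sin_ge_quarter (PI * y)%R _ _); nra.
apply: (@le_trans _ _ y^-1); last by rewrite lerDl invr_ge0; lra.
by rewrite lef_pV2 ?posrE ?mulr_gt0 ?sin_PI_gt0 //; lra.
Qed.

Section UnitRoot.
Variable n : nat.
Hypothesis n_gt0 : (0 < n)%N.

Definition unit_root : R[i] := cis (2 * (PI / n%:R)).

Let nR_gt0 : 0 < n%:R :> R. Proof. by rewrite ltr0n. Qed.

Lemma norm_1_sub_unit_rootX x : `|1 - unit_root ^+ x| = (2 * `|sin (PI * (x%:R / n%:R))%R|)%:C.
Proof.
rewrite /unit_root cisX mulrCA norm_1_sub_cis; congr (2 * `|sin _|)%:C.
by rewrite mulrCA.
Qed.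

Lemma natr_div_bounds x : (0 < x < n)%N -> 0 < x%:R / n%:R :> R /\ x%:R / n%:R < 1 :> R.
Proof.
move=> /andP[x_gt0 lt_xn]; split; first by rewrite divr_gt0 ?ltr0n.
by rewrite ltr_pdivrMr // mul1r ltr_nat.
Qed.

Lemma unit_root_primitive : n.-primitive_root unit_root.
Proof.
apply/andP; split=> //; apply/forallP => i; apply/eqP; rewrite unity_rootE.
have [->|neq_in] := eqVneq i.+1 n.
  rewrite /unit_root cisX (_ : _ * _ = 2 * PI)%R; last by field; rewrite gt_eqF.
  by rewrite /cis -[2]/(2%coqR) -RmultE cos_2PI sin_2PI; apply/eqP.
have lt_in : (0 < i.+1 < n)%N by rewrite ltn0Sn ltn_neqAle neq_in ltn_ord.
have [ratio_gt0 ratio_lt1] := natr_div_bounds lt_in.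
have sin_gt0 := sin_PI_gt0 ratio_gt0 ratio_lt1.
apply/negP => /eqP root1; have := norm_1_sub_unit_rootX i.+1.
rewrite root1 subrr normr0 => /(congr1 (@complex.Re R))/esym/eqP /=.
by rewrite mulf_eq0 pnatr_eq0 normr_eq0 (gt_eqF sin_gt0).
Qed.

Lemma inv_norm_1_sub_unit_rootX_le x : (0 < x < n)%N ->
  `|1 - unit_root ^+ x|^-1 <= (n%:R * (x%:R^-1 + (n - x)%:R^-1))%:C.
Proof.
move=> x_range; have [ratio_gt0 ratio_lt1] := natr_div_bounds x_range.
have /andP[x_gt0 lt_xn] := x_range.
rewrite norm_1_sub_unit_rootX -fmorphV lecR gtr0_norm ?sin_PI_gt0 //.
apply: le_trans (inv_sin_PI_le ratio_gt0 ratio_lt1) _.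
have nx_gt0 : 0 < n%:R - x%:R :> R by rewrite subr_gt0 ltr_nat.
have -> : 1 - x%:R / n%:R = (n%:R - x%:R) / n%:R :> R by field; rewrite gt_eqF.
by rewrite natrB ?(ltnW lt_xn) // !invf_div mulrDr.
Qed.

Lemma chord_sum_unit_root_le : chord_sum n unit_root <= (2 * n%:R * (1 + ln n%:R))%:C.
Proof.
pose H : R := \sum_(x < n) x.+1%:R^-1.
have H_le : H <= 1 + ln n%:R by have := harmonic_le_ln n.-1; rewrite prednK.
apply: (@le_trans _ _ (\sum_(x < n) (n%:R * (x%:R^-1 + (n - x)%:R^-1))%:C)).
  apply: ler_sum => x _; have [->|x_neq0] := eqVneq (x : nat) 0%N; last first.
    by apply: inv_norm_1_sub_unit_rootX_le; rewrite lt0n x_neq0 ltn_ord.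
  by rewrite expr0 subrr normr0 invr0 ler0c mulr_ge0 ?addr_ge0 ?invr_ge0.
rewrite -rmorph_sum lecR /= -mulr_sumr big_split /=.
have -> : \sum_(x < n) (n - x)%:R^-1 = H.
  by rewrite (reindex_inj rev_ord_inj); apply: eq_bigr => x _; rewrite /= subKn.
have sum_inv_le : \sum_(x < n) x%:R^-1 <= H.
  rewrite /H; case: (n) => [|k]; first by rewrite !big_ord0.
  by rewrite big_ord_recl invr0 add0r big_ord_recr /= lerDl invr_ge0.
have -> : 2 * n%:R * (1 + ln n%:R) = n%:R * (1 + ln n%:R + (1 + ln n%:R)) :> R by ring.
by rewrite ler_wpM2l // lerD // (le_trans sum_inv_le).
Qed.

End UnitRoot.

(** * The energy of the rotated Jacobi sequence *)

Lemma norm_real_complex (x : R) : `|x%:C| = `|x|%:C.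
Proof. by rewrite normc_def /= expr0n addr0 sqrtr_sqr. Qed.

Lemma energy_jacobiR n r : odd n -> squarefree n -> (1 < n)%N ->
  `|n%:R ^+ 2 * energy n (fun a => jacobiR n (a + r)) -
     (n%:R ^+ 4 + 2 * n%:R * \sum_(a < n) (a%:R - (reflect_idx n r a)%:R) ^+ 2)| <=
  (noncoprimes n)%:R * (3 * n%:R ^+ 3 + 12 * n%:R * (2 * n%:R * (1 + ln n%:R)) ^+ 2).
Proof.
move=> n_odd n_sqf n_gt1; have n_gt0 := ltnW n_gt1.
pose chi a := (jacobiR n a)%:C.
have chi_real a : (chi a)^* = chi a by apply: conj_Creal; rewrite complex_real.
have chi_sqr a : chi a ^+ 2 = (coprime a n)%:R.
  by rewrite /chi -rmorphXn /= jacobiR_sqr // rmorph_nat.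
have chi_mod a : chi (a %% n)%N = chi a by rewrite /chi jacobiR_modn.
have chiM a b : chi (a * b)%N = chi a * chi b by rewrite /chi jacobiRM // rmorphM.
have chi_primitive p : prime p -> (p %| n)%N ->
    exists2 u, (u = 1 %[mod n %/ p])%N & chi u = -1.
  move=> p_prime p_n; have [u u_np jacobi_u] := jacobiR_primitive n_odd n_sqf p_prime p_n.
  by exists u => //; rewrite /chi jacobi_u rmorphN1.
have := energy_character_close (unit_root_primitive n_gt0) n_gt1 chi_mod chiM chi_sqr chi_real
  chi_primitive r.
have -> : off_support n chi = (noncoprimes n)%:R.
  rewrite /off_support natr_sum; apply: eq_bigr => a _.
  by rewrite chi_sqr; case: coprime; rewrite ?subrr ?subr0.
rewrite (rmorph_energy (real_complex R) n (fun a => jacobiR n (a + r))).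
have := chord_sum_ge0 n (unit_root n); have := chord_sum_unit_root_le n_gt0.
move: (chord_sum n _) (2 * _ * (1 + ln _)) => H L H_le H_ge0 bound.
have reflect_sum : \sum_(a < n) (a%:R - (reflect_idx n r a)%:R) ^+ 2 =
    (\sum_(a < n) (a%:R - (reflect_idx n r a)%:R) ^+ 2)%:C.
  by rewrite rmorph_sum; apply: eq_bigr => a _; rewrite /= rmorphXn rmorphB /= !rmorph_nat.
rewrite reflect_sum in bound.
rewrite -lecR -norm_real_complex !(rmorph_nat, rmorphXn, rmorphB, rmorphD, rmorphM).
apply: le_trans bound _; rewrite ler_wpM2l // lerD2l ler_wpM2l ?mulr_ge0 //.
by apply: lerXn2r; rewrite ?nnegrE // (le_trans H_ge0).
Qed.

Definition parabola (K : pzRingType) (x : K) : K := x * (1 - x).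

Lemma sum_ord_sqr (K : comPzRingType) n :
  6 * \sum_(a < n) a%:R ^+ 2 = n%:R * (n%:R - 1) * (2 * n%:R - 1) :> K.
Proof.
elim: n => [|n IHn]; first by rewrite !big_ord0; ring.
by rewrite !big_ord_recr /= mulrDr IHn -addn1 natrD; ring.
Qed.

Lemma sum_ord_threshold (K : pzRingType) n k (x y : K) : (k <= n)%N ->
  \sum_(a < n) (if (a < k)%N then x else y) = k%:R * x + (n%:R - k%:R) * y.
Proof.
move=> le_kn; rewrite -natrB // -[in LHS](subnKC le_kn) big_split_ord /=.
rewrite (eq_bigr (fun=> x)) => [|i _]; last by rewrite ltn_ord.
rewrite [X in _ + X](eq_bigr (fun=> y)) => [|i _]; last by rewrite ltnNge leq_addr.
by rewrite !sumr_const !card_ord !mulr_natl.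
Qed.

Section ReflectDistance.
Variables (n r : nat).
Hypothesis n_gt0 : (0 < n)%N.
Local Notation s := (reflect_idx n r).

Lemma reflect_idx_add a : (a < n)%N ->
  (s a + a = if a < (s 0).+1 then s 0 else s 0 + n)%N.
Proof.
move=> lt_an; have lt_sa := ltn_reflect_idx r n_gt0 a; have lt_s0 := ltn_reflect_idx r n_gt0 0.
have eq_mod : (s a + a = s 0 %[mod n])%N.
  rewrite /reflect_idx modn_mod modnDml mulnDr add0n addnAC.
  by rewrite -modnDml [(_ + a)%N]addnC addn_predn_mul // modnDml add0n.
rewrite (modn_small lt_s0) in eq_mod.
have [lt_sum|ge_sum] := ltnP (s a + a) n.
  by rewrite modn_small // in eq_mod; rewrite eq_mod; case: ifP => //; lia.
have sum_s : (s a + a = s 0 + n)%N.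
  by rewrite -(subnK ge_sum) -eq_mod -(subnK ge_sum) modnDr modn_small; lia.
by rewrite sum_s; case: ifP => //; lia.
Qed.

Lemma sum_reflect_diff_sqr (K : comPzRingType) :
  \sum_(a < n) (a%:R - (s a)%:R) ^+ 2 =
  4 * \sum_(a < n) a%:R ^+ 2 -
   ((s 0)%:R + 1) * (s 0)%:R ^+ 2 - (n%:R - (s 0)%:R - 1) * ((s 0)%:R + n%:R) ^+ 2 :> K.
Proof.
have sum_add : \sum_(a < n) ((s a)%:R + a%:R) ^+ 2 =
    (s 0).+1%:R * (s 0)%:R ^+ 2 + (n%:R - (s 0).+1%:R) * ((s 0)%:R + n%:R) ^+ 2 :> K.
  rewrite -sum_ord_threshold ?ltn_reflect_idx //; apply: eq_bigr => a _.
  by rewrite -natrD (reflect_idx_add (ltn_ord a)); case: ifP => // _; rewrite natrD.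
have parallelogram : \sum_(a < n) (a%:R - (s a)%:R) ^+ 2 + \sum_(a < n) ((s a)%:R + a%:R) ^+ 2 =
    2 * \sum_(a < n) a%:R ^+ 2 + 2 * \sum_(a < n) (s a)%:R ^+ 2 :> K.
  by rewrite !mulr_sumr -!big_split /=; apply: eq_bigr => a _; ring.
rewrite -[LHS](addrK (\sum_(a < n) ((s a)%:R + a%:R) ^+ 2)) parallelogram sum_add.
by rewrite (sum_reflect_idx r n_gt0 (fun a => a%:R ^+ 2)) -addn1 natrD; ring.
Qed.

Lemma sum_reflect_diff_sqr_close (K : realFieldType) :
  `|2 * (\sum_(a < n) (a%:R - (s a)%:R) ^+ 2) / n%:R ^+ 3 -
    (2 / 3 - 2 * parabola ((s 0)%:R / n%:R))| <= 4 / n%:R :> K.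
Proof.
rewrite /parabola.
have -> : \sum_(a < n) (a%:R - (s a)%:R) ^+ 2 =
    4 * (n%:R * (n%:R - 1) * (2 * n%:R - 1) / 6) - ((s 0)%:R + 1) * (s 0)%:R ^+ 2
     - (n%:R - (s 0)%:R - 1) * ((s 0)%:R + n%:R) ^+ 2 :> K.
  by rewrite sum_reflect_diff_sqr -sum_ord_sqr [6 * _]mulrC mulfK // pnatr_eq0.
have s0_le : (s 0)%:R <= n%:R :> K by rewrite ler_nat ltnW // ltn_reflect_idx.
have n_ge1 : 1 <= n%:R :> K by rewrite ler1n.
have := ler0n K (s 0); move: (n%:R) ((s 0)%:R) n_ge1 s0_le => N x N_ge1 x_le x_ge0.
have N_neq0 : N != 0 by rewrite gt_eqF; lra.
have -> : 2 * (4 * (N * (N - 1) * (2 * N - 1) / 6) - (x + 1) * x ^+ 2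
    - (N - x - 1) * (x + N) ^+ 2) / N ^+ 3 - (2 / 3 - 2 * (x / N * (1 - x / N))) =
    (4 * (x / N) - 2 + 4 / 3 * N^-1) * N^-1 by field.
have invN_gt0 : 0 < N^-1 by rewrite invr_gt0; lra.
have invN_le1 : N^-1 <= 1 by rewrite invf_le1; lra.
have ratio_le1 : x / N <= 1 by rewrite ler_pdivrMr; lra.
have ratio_ge0 : 0 <= x / N by rewrite mulr_ge0 // ltW.
by rewrite normrM (gtr0_norm invN_gt0) ler_pM2r // ler_norml; apply/andP; split; lra.
Qed.

End ReflectDistance.

Lemma parabolaC (K : comPzRingType) (x : K) : parabola (1 - x) = parabola x.
Proof. by rewrite /parabola; ring. Qed.

Lemma periodic_parabola_lipschitz (K : archiRealFieldType) (x y d : K) :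
  0 <= x <= 1 -> 0 <= y <= 1 -> x - y - d \is a Num.int ->
  `|parabola x - parabola y| <= `|d|.
Proof.
rewrite /parabola => /andP[x_ge0 x_le1] /andP[y_ge0 y_le1] /intrP[k diff].
have [d_ge1|d_lt1] := lerP 1 `|d|.
  by apply: le_trans d_ge1; rewrite ler_norml; apply/andP; split; nra.
have := ler_norm d; have := ler_norm (- d); rewrite normrN => d_lo d_hi.
have k_range : (-2 < k < 2)%R.
  by apply/andP; split; rewrite -(ltr_int K) -diff; lra.
have : k = -1 \/ k = 0 \/ k = 1 by lia.
by rewrite ler_norml; case=> [|[|]] k_val; rewrite k_val in diff; apply/andP; split; nra.
Qed.

Lemma IZR_int k : IZR k \is a Num.int.
Proof.
case: k => [|p|p]; rewrite ?rpred0 //; first by rewrite !RealsE natr_int.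
by rewrite -[Z.neg p]/(- Z.pos p)%coqZ opp_IZR !RealsE rpredN natr_int.
Qed.

Lemma Zfloor_bounds (x : R) : 0 <= x - IZR (Zfloor x) <= 1.
Proof.
have [/RltP up_gt /RleP up_le] := archimed x.
rewrite /Zfloor minus_IZR; move: up_gt up_le; rewrite !RealsE => up_gt up_le.
by apply/andP; split; lra.
Qed.

Lemma red_int r : r - red r \is a Num.int.
Proof. by rewrite /red RminusE subKr IZR_int. Qed.

Lemma red_bounds r : - 2^-1 < red r <= 2^-1.
Proof.
have [/RltP up_gt /RleP up_le] := archimed (/ 2 - r)%coqR.
rewrite /red minus_IZR; move: up_gt up_le; rewrite !RealsE /= => up_gt up_le.
by apply/andP; split; lra.
Qed.

Lemma norm_red_le r : `|red r| <= 2^-1.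
Proof. by have /andP[red_lo red_hi] := red_bounds r; rewrite ler_norml ltW. Qed.

Lemma inv_f r : (Defs.f r)^-1 = 2 / 3 - 2 * parabola (2 * `|red r|).
Proof. by rewrite /parabola /Defs.f !RealsE /= invrK; field. Qed.

Definition rot_shift (n : nat) (r : R) : nat :=
  Z.to_nat (Z.modulo (Zfloor (INR n * r)) (Z.of_nat n)).

Lemma Z_of_nat_modn a n : (0 < n)%N -> Z.of_nat (a %% n) = Z.modulo (Z.of_nat a) (Z.of_nat n).
Proof.
move=> n_gt0; rewrite {2}(divn_eq a n) Nat2Z.inj_add Nat2Z.inj_mul Z.add_comm.
by rewrite Z_mod_plus_full Z.mod_small //; have := ltn_pmod a n_gt0; lia.
Qed.

Lemma rotE n k r (a : nat -> R) : (k < n)%N -> Defs.rot n r a k = a ((k + rot_shift n r) %% n)%N.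
Proof.
move=> lt_kn; have n_gt0 : (0 < n)%N by apply: leq_ltn_trans lt_kn.
rewrite /Defs.rot lt_kn /rot_shift; set fl := Zfloor _; congr a.
have [fl_mod_ge0 _] := Z.mod_pos_bound fl (Z.of_nat n) ltac:(lia).
rewrite -Zplus_mod_idemp_r -{1}(Z2Nat.id _ fl_mod_ge0) -Nat2Z.inj_add.
by rewrite -Z_of_nat_modn // Nat2Z.id.
Qed.

Lemma rot_shift_int n r : (0 < n)%N ->
  ((rot_shift n r)%:R - IZR (Zfloor (INR n * r))) / n%:R \is a Num.int.
Proof.
move=> n_gt0; rewrite /rot_shift; set fl := Zfloor _.
have [fl_mod_ge0 _] := Z.mod_pos_bound fl (Z.of_nat n) ltac:(lia).
have -> : (Z.to_nat (fl mod Z.of_nat n))%:R = IZR fl - n%:R * IZR (fl / Z.of_nat n).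
  rewrite -INRE INR_IZR_INZ Z2Nat.id // Z.mod_eq ?minus_IZR ?mult_IZR; last by lia.
  by rewrite -INR_IZR_INZ INRE.
by rewrite addrAC subrr sub0r mulNr [n%:R * _]mulrC mulfK ?rpredN ?IZR_int // pnatr_eq0 -lt0n.
Qed.

Lemma reflect_idx0_int (K : archiRealFieldType) n r : (0 < n)%N ->
  ((reflect_idx n r 0)%:R + 2 * r%:R) / n%:R \is a @Num.int K.
Proof.
move=> n_gt0; have /dvdnP[q sum_q] : (n %| reflect_idx n r 0 + 2 * r)%N.
  by rewrite /dvdn modnDml add0n addnC addn_predn_mul // mod0n.
by rewrite -natrM -natrD sum_q natrM mulfK ?natr_int // pnatr_eq0 -lt0n.
Qed.

(* Modulo 1, reflect_idx 0 / n is -2 floor(n r) / n, which is within 2 / n of -2 r. *)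
Lemma reflect_idx0_close n r : (0 < n)%N ->
  `|parabola ((reflect_idx n (rot_shift n r) 0)%:R / n%:R) - parabola (2 * `|red r|)| <= 2 / n%:R.
Proof.
move=> n_gt0; set x := _ / n%:R; have nR_gt0 : 0 < n%:R :> R by rewrite ltr0n.
pose fl : R := IZR (Zfloor (INR n * r)); pose d := 2 * (n%:R * r - fl) / n%:R.
have d_le : `|d| <= 2 / n%:R.
  have := Zfloor_bounds (INR n * r); rewrite -/fl !RealsE => /andP[lo hi].
  rewrite normrM normfV normr_nat ler_pM2r ?invr_gt0 // normrM normr_nat ger0_norm //.
  by rewrite ler_piMr.
have x_range : 0 <= x <= 1.
  by rewrite divr_ge0 ?ler0n //= ler_pdivrMr // mul1r ler_nat ltnW // ltn_reflect_idx.
have diff_int : x + 2 * red r - d \is a Num.int.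
  have -> : x + 2 * red r - d = (reflect_idx n (rot_shift n r) 0 + 2 * rot_shift n r)%:R / n%:R
      - 2 * (((rot_shift n r)%:R - fl) / n%:R) - 2 * (r - red r).
    by rewrite /x /d natrD natrM; field; rewrite gt_eqF.
  rewrite natrD natrM; apply: rpredB; last by rewrite rpredM ?natr_int ?red_int.
  apply: rpredB; first exact: reflect_idx0_int.
  by rewrite rpredM ?natr_int ?rot_shift_int.
have y_le := norm_red_le r; apply: le_trans d_le.
have [red_ge0|red_lt0] := lerP 0 (red r).
  rewrite ger0_norm // in y_le *; rewrite -[parabola (2 * _)]parabolaC.
  apply: periodic_parabola_lipschitz => //; first by apply/andP; split; lra.
  have -> : x - (1 - 2 * red r) - d = x + 2 * red r - d - 1 by ring.
  by rewrite rpredB ?rpred1.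
rewrite ltr0_norm // in y_le *; apply: periodic_parabola_lipschitz => //.
  by apply/andP; split; lra.
by rewrite mulrN opprK.
Qed.

Lemma jacobiR0 n : (1 < n)%N -> jacobiR n 0 = 0.
Proof.
move=> n_gt1; apply/eqP; rewrite -sqrf_eq0 jacobiR_sqr ?(ltnW n_gt1) //.
by rewrite /coprime gcd0n (gtn_eqF n_gt1).
Qed.

Lemma rot_Jcoef n r k : (1 < n)%N -> (k < n)%N ->
  Defs.rot n r (Jcoef n) k = jacobiR n (k + rot_shift n r).
Proof.
move=> n_gt1 lt_kn; rewrite rotE // /Jcoef ltn_pmod ?(ltnW n_gt1) // andbT lt0n.
rewrite -jacobiR_modn; case: eqP => //= ->.
by rewrite jacobiR0.
Qed.

Lemma rot_Jcoef_sqr n r k : (1 < n)%N -> (k < n)%N ->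
  Defs.rot n r (Jcoef n) k ^+ 2 = (coprime (k + rot_shift n r) n)%:R.
Proof. by move=> n_gt1 lt_kn; rewrite rot_Jcoef // jacobiR_sqr // ltnW. Qed.

Lemma energy_rot_Jcoef_close n r : odd n -> squarefree n -> (1 < n)%N ->
  `|energy n (Defs.rot n r (Jcoef n)) / n%:R ^+ 2 - (1 + (Defs.f r)^-1)| <=
  (3 + 48 * (1 + ln n%:R) ^+ 2) * ((noncoprimes n)%:R / n%:R) + 8 / n%:R.
Proof.
move=> n_odd n_sqf n_gt1; have n_gt0 := ltnW n_gt1.
rewrite (@eq_energy _ n _ (fun a => jacobiR n (a + rot_shift n r))) => [|k lt_kn]; last first.
  exact: rot_Jcoef.
have := energy_jacobiR (rot_shift n r) n_odd n_sqf n_gt1.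
have := sum_reflect_diff_sqr_close (rot_shift n r) n_gt0 R.
have := reflect_idx0_close r n_gt0; rewrite inv_f /=.
have : 0 < n%:R :> R by rewrite ltr0n.
set T := energy n _; set S := \sum_(a < n) _; set y := parabola (2 * _).
set x := parabola _; set N := n%:R; set L := 1 + ln _; set m := (noncoprimes n)%:R.
move=> N_gt0 parabola_close sum_close energy_le.
have {}energy_le : `|T / N ^+ 2 - (1 + 2 * S / N ^+ 3)| <= (3 + 48 * L ^+ 2) * (m / N).
  have -> : T / N ^+ 2 - (1 + 2 * S / N ^+ 3) = (N ^+ 2 * T - (N ^+ 4 + 2 * N * S)) / N ^+ 4.
    by field; rewrite gt_eqF.
  rewrite normrM normfV [`|N ^+ 4|]gtr0_norm ?exprn_gt0 // ler_pdivrMr ?exprn_gt0 //.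
  apply: le_trans energy_le _; rewrite le_eqVlt; apply/orP; left; apply/eqP.
  by field; rewrite gt_eqF.
have -> : T / N ^+ 2 - (1 + (2 / 3 - 2 * y)) = (T / N ^+ 2 - (1 + 2 * S / N ^+ 3))
    + (2 * S / N ^+ 3 - (2 / 3 - 2 * x) - 2 * (x - y)) by ring.
apply: le_trans (ler_normD _ _) _; apply: lerD => //.
have -> : 8 / N = 4 / N + 2 * (2 / N) by ring.
apply: le_trans (ler_normB _ _) _; apply: lerD => //.
by rewrite normrM normr_nat ler_wpM2l.
Qed.

(** * Deviation of the merit factor *)

Lemma inv_f_bounds r : 6^-1 <= (Defs.f r)^-1 <= 2 / 3.
Proof.
have := norm_red_le r; have := normr_ge0 (red r); rewrite inv_f /parabola.
by move: `|red r| => x x_ge0 x_le; have := sqr_ge0 (x - 4^-1); move=> ?; apply/andP; split; nra.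
Qed.

Lemma dist_inv_le (K : realFieldType) (c eta x l : K) :
  0 < c -> c <= l -> eta <= c / 2 -> `|x - l| <= eta -> `|x^-1 - l^-1| <= 2 / c ^+ 2 * eta.
Proof.
move=> c_gt0 c_le eta_le dist_le.
have x_ge : c / 2 <= x by move: dist_le; rewrite ler_norml => /andP[lo _]; lra.
have x_gt0 : 0 < x by lra.
have l_gt0 : 0 < l by lra.
have -> : x^-1 - l^-1 = (l - x) / (x * l) by field; rewrite !gt_eqF.
rewrite normrM normfV distrC (gtr0_norm (mulr_gt0 x_gt0 l_gt0)) ler_pdivrMr ?mulr_gt0 //.
have eta_ge0 : 0 <= eta := le_trans (normr_ge0 _) dist_le.
apply: le_trans dist_le _.
rewrite mulrAC -[leLHS]mul1r ler_wpM2r //.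
have -> : 2 / c ^+ 2 * (x * l) = x / (c / 2) * (l / c) by field; rewrite gt_eqF.
by rewrite -[1]mulr1 ler_pM // ler_pdivlMr ?mul1r ?divr_gt0.
Qed.

Section LogRatio.
Variable n : nat.
Hypotheses (n_odd : odd n) (n_gt1 : (1 < n)%N).

Definition log_ratio : R := ln n%:R ^+ 7 / (pdiv n)%:R.

Let nR_gt0 : 0 < n%:R :> R. Proof. by rewrite ltr0n ltnW. Qed.
Let pdivR_gt0 : 0 < (pdiv n)%:R :> R. Proof. by rewrite ltr0n pdiv_gt0. Qed.

Lemma ln_ge1 : 1 <= ln n%:R.
Proof.
have n_ge3 : 3 <= n%:R :> R.
  by rewrite (ler_nat R 3) ltn_neqAle n_gt1 andbT; case: eqP n_odd => // <-.
rewrite -[leLHS](ln_exp 1); apply/RleP/ln_le; first exact: exp_pos.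
by apply/RleP; apply: le_trans _ n_ge3; have /RleP := exp_le_3; rewrite !RealsE.
Qed.

Lemma ln_exp_le_log_ratio k : (k <= 7)%N -> ln n%:R ^+ k / (pdiv n)%:R <= log_ratio.
Proof.
move=> k_le7; rewrite /log_ratio ler_pM2r ?invr_gt0 //.
by apply: ler_weXn2l; rewrite ?ln_ge1.
Qed.

Lemma log_ratio_gt0 : 0 < log_ratio.
Proof. by apply: lt_le_trans _ (ln_exp_le_log_ratio (leq0n 7)); rewrite expr0 divr_gt0. Qed.

Lemma inv_le_log_ratio : n%:R^-1 <= log_ratio.
Proof.
apply: le_trans _ (ln_exp_le_log_ratio (leq0n 7)); rewrite expr0 mul1r.
by rewrite lef_pV2 ?posrE // ler_nat pdiv_leq // ltnW.
Qed.

Lemma noncoprimes_le_log_ratio : (noncoprimes n)%:R / n%:R <= 2 * log_ratio.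
Proof.
apply: le_trans (noncoprimes_ratio_le (ltnW n_gt1)) _.
by rewrite -mulrA ler_wpM2l // (ln_exp_le_log_ratio (k := 1)).
Qed.

Lemma energy_rot_Jcoef_log_ratio r : squarefree n ->
  `|energy n (Defs.rot n r (Jcoef n)) / n%:R ^+ 2 - (1 + (Defs.f r)^-1)| <= 398 * log_ratio.
Proof.
move=> n_sqf; apply: le_trans (energy_rot_Jcoef_close r n_odd n_sqf n_gt1) _.
have := noncoprimes_ratio_le (ltnW n_gt1); have := inv_le_log_ratio.
have := ln_exp_le_log_ratio (k := 3) isT; have := ln_ge1.
set l := ln n%:R; set m := _ / n%:R; set p := (pdiv n)%:R => l_ge1 l3_le inv_le m_le.
have coef_le : (3 + 48 * (1 + l) ^+ 2) * m <= 195 * l ^+ 2 * (2 * l / p).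
  apply: ler_pM => //; last by nra.
  - by rewrite addr_ge0 // mulr_ge0 // sqr_ge0.
  - by rewrite divr_ge0.
have -> : 398 * log_ratio = 390 * log_ratio + 8 * log_ratio by ring.
apply: lerD; last by rewrite ler_wpM2l.
apply: le_trans coef_le _.
have -> : 195 * l ^+ 2 * (2 * l / p) = 390 * (l ^+ 3 / p) by ring.
by rewrite ler_wpM2l.
Qed.

End LogRatio.

Lemma code3N x : code3 (- x) = - code3 x.
Proof.
by case: x => [[|[|[|]]]] // ?; rewrite /code3 /= ?(opp_IZR 1) ?RoppE ?opprK ?oppr0.
Qed.

Lemma code3_sqr x : code3 x ^+ 2 = (val x != 0%N)%:R.
Proof.
by case: x => [[|[|[|]]]] // ?; rewrite /code3 /= ?(opp_IZR 1) ?sqrrN ?expr1n ?expr0n.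
Qed.

Section Deviation.
Variables (n : nat) (r : R).
Hypotheses (n_odd : odd n) (n_sqf : squarefree n) (n_gt1 : (1 < n)%N).
Let n_gt0 : (0 < n)%N. Proof. exact: ltnW. Qed.
Let nR_gt0 : 0 < n%:R :> R. Proof. by rewrite ltr0n. Qed.
Local Notation J := (Defs.rot n r (Jcoef n)).
Local Notation V v := (Defs.rot n r (Vcoef v)).
Local Notation JV v := (fun k => J k + V v k).
Local Notation rho := (log_ratio n).

Let rot_idx (k : nat) : 'I_n := Ordinal (ltn_pmod (k + rot_shift n r) n_gt0).

Lemma rot_Vcoef (v : {ffun 'I_n -> 'I_3}) k : (k < n)%N -> V v k = code3 (v (rot_idx k)).
Proof.
move=> lt_kn; rewrite rotE // /Vcoef insubT /=; first by rewrite ltn_pmod.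
by move=> lt_rot_idx; congr (code3 (v _)); apply: val_inj.
Qed.

Lemma rot_Vcoef_sqr v k : v \in Vn n -> (k < n)%N ->
  V v k ^+ 2 = (~~ coprime (k + rot_shift n r) n)%:R.
Proof.
rewrite inE => /forallP/(_ (rot_idx k))/eqP support_v lt_kn.
by rewrite rot_Vcoef // code3_sqr support_v /= coprime_modl.
Qed.

Lemma rot_Vcoef_flip i : (i < n)%N ->
  exists phi : {ffun 'I_n -> 'I_3} -> {ffun 'I_n -> 'I_3},
  [/\ injective phi, forall v, (phi v \in Vn n) = (v \in Vn n),
      forall v, V (phi v) i = - V v i &
      forall v j, (j < n)%N -> j != i -> V (phi v) j = V v j].
Proof.
move=> lt_in.
pose phi (v : {ffun 'I_n -> 'I_3}) := [ffun j => if j == rot_idx i then - v j else v j].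
have phiK : involutive phi.
  by move=> v; apply/ffunP => j; rewrite !ffunE; case: (j == rot_idx i); rewrite ?opprK.
exists phi; split=> [|v|v|v j lt_jn neq_ji]; first exact: inv_inj.
- rewrite !inE; apply: eq_forallb => j; rewrite ffunE; case: ifP => // _.
  by congr (_ == _); apply: oppr_eq0 (v j).
- by rewrite !rot_Vcoef // ffunE eqxx code3N.
rewrite !rot_Vcoef // ffunE; case: eqP => // /(congr1 val) /= /eqP.
by rewrite eqn_modDr !modn_small // (negPf neq_ji).
Qed.

Lemma JV_sqr v k : v \in Vn n -> (k < n)%N -> JV v k ^+ 2 = 1.
Proof.
move=> vV lt_kn; have := rot_Vcoef_sqr vV lt_kn; have := rot_Jcoef_sqr r n_gt1 lt_kn.
case: coprime => /= J_sqr V_sqr.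
  by move/eqP: V_sqr; rewrite sqrf_eq0 => /eqP ->; rewrite addr0.
by move/eqP: J_sqr; rewrite sqrf_eq0 => /eqP ->; rewrite add0r.
Qed.

Lemma merit_JV v : v \in Vn n -> merit n (JV v) = (energy n (JV v) / n%:R ^+ 2 - 1)^-1.
Proof.
move=> vV; rewrite /merit Lpow4 Lpow2 (eq_bigr (fun=> 1)) => [|k _]; last exact: JV_sqr.
rewrite sumr_const card_ord !RealsE -[LHS]invf_div; congr _^-1.
by field; rewrite gt_eqF.
Qed.

Lemma sum_conv_sqr_dist_JV_le :
  \sum_(v in Vn n) conv_sqr_dist n J (JV v) <=
  #|Vn n|%:R * (20 * n%:R * (noncoprimes n)%:R).
Proof.
have -> : noncoprimes n = support_size n (fun k => ~~ coprime (k + rot_shift n r) n).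
  rewrite /support_size (@sum_addn_modn _ n _ (fun a => nat_of_bool (~~ coprime a n))) //.
  by move=> a; rewrite coprime_modl.
apply: sum_conv_sqr_dist_le => [i|v i|i].
- exact: rot_Vcoef_flip.
- exact: rot_Vcoef_sqr.
- case: (ltnP i n) => [lt_in|le_ni]; first by rewrite rot_Jcoef_sqr // lern1 leq_b1.
  by rewrite /Defs.rot ltnNge le_ni /= expr0n /= ler01.
Qed.

Definition energy_deviation (v : {ffun 'I_n -> 'I_3}) : R :=
  `|energy n (JV v) / n%:R ^+ 2 - (1 + (Defs.f r)^-1)|.

Lemma energy_deviation_le v (e : R) : rho <= 1 -> 0 < e ->
  energy_deviation v <=
  398 * rho + 400 * e + (1 + e^-1) / n%:R ^+ 2 * conv_sqr_dist n J (JV v).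
Proof.
move=> rho_le1 e_gt0; have n2_gt0 : 0 < n%:R ^+ 2 :> R by rewrite exprn_gt0.
have J_close := energy_rot_Jcoef_log_ratio n_odd n_gt1 r n_sqf.
have J_le : energy n J / n%:R ^+ 2 <= 400.
  have /andP[_ inv_f_le] := inv_f_bounds r.
  by move: J_close; rewrite ler_norml => /andP[_]; lra.
have JV_close := energy_close n J (JV v) e_gt0.
rewrite /energy_deviation.
have -> : energy n (JV v) / n%:R ^+ 2 - (1 + (Defs.f r)^-1) =
    (energy n J / n%:R ^+ 2 - (1 + (Defs.f r)^-1)) + (energy n (JV v) - energy n J) / n%:R ^+ 2.
  by rewrite mulrBl; ring.
rewrite -[leRHS]addrA; apply: le_trans (ler_normD _ _) _; apply: lerD => //.
rewrite normrM normfV (gtr0_norm n2_gt0) ler_pdivrMr //; apply: le_trans JV_close _.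
rewrite [leRHS]mulrDl [_ / _ * _ * _]mulrAC divfK ?gt_eqF // lerD2r.
have -> : 400 * e * n%:R ^+ 2 = e * (400 * n%:R ^+ 2) by ring.
by rewrite ler_pM2l // -ler_pdivrMr.
Qed.

(* Taking e = sqrt rho balances the terms e and rho / e coming from energy_deviation_le. *)
Lemma sum_energy_deviation_le : rho <= 1 ->
  \sum_(v in Vn n) energy_deviation v <= #|Vn n|%:R * (1000 * Num.sqrt rho).
Proof.
move=> rho_le1; have rho_gt0 := log_ratio_gt0 n_odd n_gt1.
set e := Num.sqrt rho; have e_gt0 : 0 < e by rewrite sqrtr_gt0.
have inv_e_ge0 : 0 <= 1 + e^-1 by rewrite addr_ge0 // invr_ge0 ltW.
have rhoE : rho = e ^+ 2 by rewrite sqr_sqrtr ?ltW.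
have e_le1 : e <= 1 by rewrite -sqrtr1 ler_wsqrtr.
apply: le_trans (ler_sum _ (fun v _ => energy_deviation_le v rho_le1 e_gt0)) _.
rewrite big_split sumr_const /= -mulr_sumr -[_ *+ #|_|]mulr_natl.
have scale_ge0 : 0 <= (1 + e^-1) / n%:R ^+ 2 by rewrite divr_ge0 ?exprn_ge0.
apply: le_trans (lerD (lexx _) (ler_wpM2l scale_ge0 sum_conv_sqr_dist_JV_le)) _.
have := noncoprimes_le_log_ratio n_odd n_gt1; set m := (noncoprimes n)%:R => m_le.
have -> : (1 + e^-1) / n%:R ^+ 2 * (#|Vn n|%:R * (20 * n%:R * m)) =
    #|Vn n|%:R * (20 * ((1 + e^-1) * (m / n%:R))) by field; rewrite !gt_eqF.
rewrite -mulrDr ler_wpM2l // rhoE.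
have spread_le : (1 + e^-1) * (m / n%:R) <= 4 * e.
  apply: (@le_trans _ _ ((1 + e^-1) * (2 * e ^+ 2))); first by rewrite ler_wpM2l -?rhoE.
  have -> : (1 + e^-1) * (2 * e ^+ 2) = 2 * e ^+ 2 + 2 * e by field; rewrite gt_eqF.
  by nra.
by nra.
Qed.

Lemma merit_JV_close v eta : v \in Vn n -> eta <= 12^-1 -> energy_deviation v <= eta ->
  `|merit n (JV v) - Defs.f r| <= 72 * eta.
Proof.
move=> vV eta_le dev_le; have /andP[inv_f_ge _] := inv_f_bounds r.
rewrite merit_JV // -[Defs.f r]invrK.
have -> : 72 = 2 / (6^-1) ^+ 2 :> R by field.
by apply: dist_inv_le; rewrite -?addrA -?opprD //; lra.
Qed.

Lemma prob_dev_le (eps : R) : rho <= 1 -> 0 < eps ->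
  prob_dev n r eps <= 1000 * Num.sqrt rho / Num.min 12^-1 (eps / 72).
Proof.
move=> rho_le1 eps_gt0; set eta := Num.min _ _.
have eta_gt0 : 0 < eta by rewrite lt_min invr_gt0 divr_gt0 ?ltr0n.
have [eta_le12 eta_le_eps] : eta <= 12^-1 /\ eta <= eps / 72.
  by rewrite /eta ge_min lexx ge_min lexx orbT.
rewrite /prob_dev !RealsE; set bad := [set v in _ | _].
have bad_sub : bad \subset [set v in Vn n | eta <= energy_deviation v].
  apply/subsetP => v /setIdP[vV]; case: Rlt_dec => //= /RltP eps_lt _.
  apply/setIdP; split=> //; rewrite leNgt; apply/negP => /ltW dev_le.
  have := merit_JV_close vV eta_le12 dev_le.
  by rewrite leNgt => /negP[]; apply: le_lt_trans eps_lt; lra.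
have [->|Vn_neq0] := eqVneq #|Vn n| 0%N.
  by rewrite invr0 mulr0 !mulr_ge0 ?invr_ge0 ?sqrtr_ge0 // ltW.
rewrite ler_pdivrMr ?ltr0n ?lt0n // mulrAC ler_pdivlMr // [leRHS]mulrC.
apply: le_trans (sum_energy_deviation_le rho_le1).
have dev_ge0 v : 0 <= energy_deviation v by apply: normr_ge0.
apply: le_trans (markov_card (Vn n) eta dev_ge0).
by rewrite ler_pM2r // ler_nat subset_leq_card.
Qed.

End Deviation.

Local Close Scope ring_scope.
Local Open Scope R_scope.

Theorem theorem5 (S : nat -> Prop) (r : R) :
  (forall n, S n -> odd n /\ squarefree n /\ (1 < n)%N) ->
  (forall N : nat, exists n, S n /\ (N <= n)%N) ->
  (forall e : R, (0 < e) -> exists N : nat, forall n, S n -> (N <= n)%N ->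
      (Rabs (ln (INR n) ^ 7 / INR (pdiv n)) < e)) ->
  forall eps delta : R, (0 < eps) -> (0 < delta) ->
    exists N : nat, forall n, S n -> (N <= n)%N -> (prob_dev n r eps < delta).
Proof.
move=> S_odd_sqf _ ratio_to0 eps delta /RltP eps_gt0 /RltP delta_gt0.
pose eta : R := Num.min 12^-1%R (eps / 72)%R.
have eta_gt0 : (0 < eta)%R by rewrite lt_min invr_gt0 divr_gt0 ?ltr0n.
have bound_gt0 : (0 < delta * eta / 1000)%R by rewrite divr_gt0 ?mulr_gt0 ?ltr0n.
pose e : R := Num.min 1%R ((delta * eta / 1000) ^+ 2)%R.
have [|N ratio_lt] := ratio_to0 e; first by apply/RltP; rewrite lt_min ltr01 exprn_gt0.
exists N => n Sn le_Nn; have [n_odd [n_sqf n_gt1]] := S_odd_sqf n Sn.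
have /RltP := ratio_lt n Sn le_Nn.
rewrite !RealsE -/(log_ratio n) gtr0_norm ?log_ratio_gt0 // lt_min => /andP[rho_lt1 rho_lt].
apply/RltP; apply: le_lt_trans (prob_dev_le r n_odd n_sqf n_gt1 (ltW rho_lt1) eps_gt0) _.
rewrite -/eta ltr_pdivrMr // mulrC -ltr_pdivlMr ?ltr0n //.
by rewrite -[ltRHS]gtr0_norm // -sqrtr_sqr ltr_sqrt ?exprn_gt0.
Qed.
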